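(* Let $0 < \kappa < 1$ and $\lambda = \sqrt{1 - \kappa^2}$. Let $w$ be a solution, holomorphic near $0$, of the differential equation $(w')^2 = T_6(w) - (1 - 2\kappa^2)$ with $w(0) = 0$, and put $W = 2w^2 - 1$. Then $W$ (extends to) the elliptic function determined by $$(1 + W)(6 - P) = 4 \lambda^2,$$ where $P = \wp(\,\cdot\,; G_2, G_3)$ is the Weierstrass function with invariants $G_2 = 48(1 + 8\kappa^2)$ and $G_3 = 64(1 - 20\kappa^2 - 8\kappa^4)$.
   Context: $T_6$ is the degree six Chebyshev polynomial of the first kind, $T_6(\cos t) = \cos 6t$. $\wp(\,\cdot\,; g_2, g_3)$ denotes the Weierstrass elliptic function with invariants $g_2, g_3$, i.e. the solution of $(\wp')^2 = 4\wp^3 - g_2 \wp - g_3$ with a double pole at $0$ (principal part $z^{-2}$). *)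

(* Defs.v *)
From Stdlib Require Import Reals.
From Coquelicot Require Import Coquelicot.
Open Scope C_scope.

Fixpoint cheb_pair (n : nat) (x : C) : C * C :=
  match n with
  | O => (RtoC 1, x)
  | S m => let p := cheb_pair m x in (snd p, RtoC 2 * x * snd p - fst p)
  end.
Definition chebT (n : nat) (x : C) : C := fst (cheb_pair n x).
Definition T6 (x : C) : C := chebT 6 x.

Definition Cderiv (f : C -> C) (z l : C) : Prop :=
  @is_derive C_AbsRing C_NormedModule f z l.

(* P is a Weierstrass function with invariants g2, g3 on the punctured disc
   0 < |z| < rho: holomorphic there with derivative dP, satisfying
   (P')^2 = 4 P^3 - g2 P - g3, and with a double pole at 0 of principal
   part z^{-2} (P z - 1/z^2 extends holomorphically to the full disc). *)
Definition weierstrass_local (g2 g3 : C) (rho : R) (P dP : C -> C) : Prop :=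
  (forall z, 0 < Cmod z < rho ->
     Cderiv P z (dP z) /\
     dP z * dP z = RtoC 4 * P z * P z * P z - g2 * P z - g3) /\
  exists h dh : C -> C,
    (forall z, Cmod z < rho -> Cderiv h z (dh z)) /\
    (forall z, 0 < Cmod z < rho -> P z = / (z * z) + h z).

(* Main.v *)
Require Import Defs.
From Stdlib Require Import Reals Lra Psatz.
From Coquelicot Require Import Coquelicot.

(** Put [A = lambda^2] and [B = z^2 (6 - P)], which is holomorphic with [B 0 = -1].
    Both [w^2] and [2 A z^2 / B = 2 A / (6 - P)] solve
    [(U')^2 = 4 U (32 U^3 - 48 U^2 + 18 U - 2 A)] and are asymptotic to [-2 A z^2] at [0].
    Factoring the difference of the two equations gives a singular linear equation
    [D' ~ D / z] for the difference [D = O(z^2)], which forces [D = 0] near [0].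
    Hence the holomorphic function [2 w^2 B - 4 A z^2] vanishes near [0], and by the
    identity theorem on the whole disc.

    Derivatives are only assumed to exist pointwise, so Goursat's theorem is needed, both
    for the identity theorem and for the continuity of [w'] at [0]. It yields
    [|g(0)| <= 2 max |g|] over the boundary of a square centred at [0]; applied to
    [(g(z) - g(0)) / z] this is Cauchy's estimate, and applied to
    [F(z) ((z0 - c) / (z - c))^m] with [F] zero near [c] it shows that [F(z0) = 0]
    for [z0] close to [c]. *)

(** * Complex derivatives *)

Open Scope C_scope.

(** The obstacle is that the equation for [U] does not determine its solution at a zero: [U = 0]
    solves it too, and [U'] is a square root that branches there. What singles out the solution is
    its double zero, and taking [w ^ 2] rather than [w] avoids choosing a root of [-2 A]. Solutions
    of [D' = D / z] are multiples of [z], so [D = O(z^2)] leaves only [0]; the weight [z^(3/2)],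
    halfway between, leaves room both for the perturbed coefficient and for decay at [0]. The number
    [6] comes from moving the root [0] of the quartic to infinity: [y = 2 A / U] satisfies [(y')^2 =
    - 4 y^3 + 72 y^2 - 384 A y + 512 A^2], and [6 - y] is the variable in which the cubic loses its
    square term, as the Weierstrass form requires. No contour integral is evaluated. Only the
    imaginary part of the integral of [(g - g(0)) / z] is used, and a crude lower bound for the
    contribution of [1 / z] on a square stands in for [2 pi]. The factor [2] lost in this way is
    harmless, since the estimates serve only smallness and repeated halving. *)

Lemma Cderiv_iff (f : C -> C) (z l : C) :
  Cderiv f z l <->
  (forall eps : R, (0 < eps)%R -> exists delta : R, (0 < delta)%R /\
     forall y, Cmod (y - z) < delta ->
       (Cmod (f y - f z - l * (y - z)) <= eps * Cmod (y - z))%R).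
Proof.
  split.
  - intros [_ H] eps He.
    specialize (H z (fun P HP => HP) (mkposreal eps He)).
    destruct H as [d Hd]. exists d. split; [apply cond_pos|].
    intros y Hy. specialize (Hd y Hy).
    replace (f y - f z - l * (y - z)) with (f y - f z - (y - z) * l) by ring.
    exact Hd.
  - intros H. split; [apply is_linear_scal_l|].
    intros x Hx eps.
    assert (E : z = x) by exact (is_filter_lim_locally_unique (V := AbsRing_NormedModule C_AbsRing) z x Hx).
    subst x. destruct (H eps (cond_pos eps)) as [d [Hd H']].
    exists (mkposreal d Hd). intros y Hy. specialize (H' y Hy).
    replace (f y - f z - l * (y - z)) with (f y - f z - (y - z) * l) in H' by ring.
    exact H'.
Qed.

Lemma Cderiv_eq (f : C -> C) (z l l' : C) : Cderiv f z l -> l = l' -> Cderiv f z l'.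
Proof. now intros H <-. Qed.

Lemma Cderiv_ext_loc (f g : C -> C) (z l : C) (d : R) : (0 < d)%R ->
  (forall y, Cmod (y - z) < d -> f y = g y) -> Cderiv f z l -> Cderiv g z l.
Proof.
  intros Hd E. apply (is_derive_ext_loc (K := C_AbsRing) (V := C_NormedModule) f g z l).
  exists (mkposreal d Hd). exact E.
Qed.

Lemma Cderiv_unique (f : C -> C) (z l l' : C) : Cderiv f z l -> Cderiv f z l' -> l = l'.
Proof.
  intros H H'.
  apply is_C_derive_unique in H. apply is_C_derive_unique in H'. congruence.
Qed.

Lemma Cderiv_const (c z : C) : Cderiv (fun _ => c) z (RtoC 0).
Proof. exact (is_derive_const (K := C_AbsRing) (V := C_NormedModule) c z). Qed.

Lemma Cderiv_id (z : C) : Cderiv (fun x => x) z (RtoC 1).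
Proof.
  apply Cderiv_iff. intros eps He. exists 1%R. split; [lra|]. intros y _.
  replace (y - z - RtoC 1 * (y - z)) with (RtoC 0) by ring.
  rewrite Cmod_0. apply Rmult_le_pos; [lra | apply Cmod_ge_0].
Qed.

Lemma Cderiv_plus (f g : C -> C) (z a b : C) :
  Cderiv f z a -> Cderiv g z b -> Cderiv (fun x => f x + g x) z (a + b).
Proof. exact (is_derive_plus (K := C_AbsRing) (V := C_NormedModule) f g z a b). Qed.

Lemma Cderiv_minus (f g : C -> C) (z a b : C) :
  Cderiv f z a -> Cderiv g z b -> Cderiv (fun x => f x - g x) z (a - b).
Proof. exact (is_derive_minus (K := C_AbsRing) (V := C_NormedModule) f g z a b). Qed.

Lemma Cderiv_continuous (f : C -> C) (z l : C) : Cderiv f z l ->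
  forall eps : R, (0 < eps)%R -> exists delta : R, (0 < delta)%R /\
    forall y, Cmod (y - z) < delta -> (Cmod (f y - f z) <= eps)%R.
Proof.
  intros H eps He. destruct (proj1 (Cderiv_iff f z l) H 1%R Rlt_0_1) as [d [Hd H']].
  assert (Hl := Cmod_ge_0 l).
  exists (Rmin d (eps / (1 + Cmod l))). split.
  - apply Rmin_pos; [lra|]. apply Rdiv_lt_0_compat; lra.
  - intros y Hy.
    specialize (H' y (Rlt_le_trans _ _ _ Hy (Rmin_l _ _))).
    assert (Hy2 := Rlt_le_trans _ _ _ Hy (Rmin_r _ _)).
    replace (f y - f z) with ((f y - f z - l * (y - z)) + l * (y - z)) by ring.
    eapply Rle_trans; [apply Cmod_triangle|]. rewrite Cmod_mult.
    assert (Cmod (y - z) * (1 + Cmod l) < eps)%R.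
    { apply (Rmult_lt_reg_r (/ (1 + Cmod l))); [apply Rinv_0_lt_compat; lra|].
      rewrite Rmult_assoc, Rinv_r by lra. rewrite Rmult_1_r. exact Hy2. }
    nra.
Qed.

Lemma Cderiv_mult (f g : C -> C) (z a b : C) :
  Cderiv f z a -> Cderiv g z b -> Cderiv (fun x => f x * g x) z (a * g z + f z * b).
Proof.
  intros Hf Hg.
  apply Cderiv_iff. intros eps He.
  assert (Hfz := Cmod_ge_0 (f z)). assert (Hgz := Cmod_ge_0 (g z)). assert (Ha := Cmod_ge_0 a).
  (* The summand [eps] in the denominator forces [e <= 1], so that the product of two small errors
     is bounded by one of them. *)
  set (e := (eps / (1 + Cmod (f z) + Cmod (g z) + Cmod a + eps))%R).
  assert (He' : (0 < e)%R) by (apply Rdiv_lt_0_compat; lra).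
  assert (Ee : (e * (1 + Cmod (f z) + Cmod (g z) + Cmod a + eps) = eps)%R) by (unfold e; field; lra).
  destruct (proj1 (Cderiv_iff f z a) Hf e He') as [d1 [Hd1 H1]].
  destruct (proj1 (Cderiv_iff g z b) Hg e He') as [d2 [Hd2 H2]].
  destruct (Cderiv_continuous g z b Hg e He') as [d3 [Hd3 H3]].
  exists (Rmin d1 (Rmin d2 d3)). split; [repeat apply Rmin_pos; lra|].
  intros y Hy.
  assert (Hy1 := Rlt_le_trans _ _ _ Hy (Rmin_l _ _)).
  assert (Hy' := Rlt_le_trans _ _ _ Hy (Rmin_r _ _)).
  assert (Hy2 := Rlt_le_trans _ _ _ Hy' (Rmin_l _ _)).
  assert (Hy3 := Rlt_le_trans _ _ _ Hy' (Rmin_r _ _)).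
  specialize (H1 y Hy1). specialize (H2 y Hy2). specialize (H3 y Hy3).
  replace (f y * g y - f z * g z - (a * g z + f z * b) * (y - z)) with
    ((f y - f z - a * (y - z)) * g z + ((f y - f z - a * (y - z)) * (g y - g z)
      + (f z * (g y - g z - b * (y - z)) + a * (y - z) * (g y - g z)))) by ring.
  set (A := f y - f z - a * (y - z)) in *. set (B := g y - g z - b * (y - z)) in *.
  set (G := g y - g z) in *.
  assert (T := Cmod_triangle (A * g z) (A * G + (f z * B + a * (y - z) * G))).
  assert (T2 := Cmod_triangle (A * G) (f z * B + a * (y - z) * G)).
  assert (T3 := Cmod_triangle (f z * B) (a * (y - z) * G)).
  rewrite ?Cmod_mult in *.
  assert (0 <= Cmod (y - z))%R by apply Cmod_ge_0.
  assert (0 <= Cmod A)%R by apply Cmod_ge_0.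
  assert (0 <= Cmod B)%R by apply Cmod_ge_0.
  assert (0 <= Cmod G)%R by apply Cmod_ge_0.
  set (Y := Cmod (y - z)) in *.
  assert (Cmod A * Cmod (g z) <= e * Y * Cmod (g z))%R by nra.
  assert (e <= 1)%R by nra.
  assert (Cmod A * Cmod G <= e * Y)%R.
  { apply Rle_trans with (e * Y * 1)%R; [|lra]. apply Rmult_le_compat; lra. }
  assert (Cmod (f z) * Cmod B <= Cmod (f z) * (e * Y))%R by nra.
  assert (Cmod a * Y * Cmod G <= Cmod a * Y * e)%R.
  { apply Rmult_le_compat_l; [|lra]. apply Rmult_le_pos; lra. }
  assert (e * (1 + Cmod (f z) + Cmod (g z) + Cmod a) * Y <= eps * Y)%R.
  { apply Rmult_le_compat_r; [lra|]. nra. }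
  nra.
Qed.

Lemma Cderiv_inv_id (z : C) : z <> RtoC 0 -> Cderiv (fun x => / x) z (- / (z * z)).
Proof.
  intros Hz. assert (Hz' := proj1 (Cmod_gt_0 z) Hz).
  apply Cderiv_iff. intros eps He.
  set (k := Cmod z) in *.
  (* The error is [(y - z)^2 / (z^2 y)]. The first radius keeps [Cmod y] above [k / 2]; the second
     then makes the bound [2 (Cmod (y - z))^2 / k^3] at most [eps * Cmod (y - z)]. *)
  exists (Rmin (k / 2) (eps * (k * k * k) / 2)). split.
  { apply Rmin_pos; [lra|]. assert (0 < k * k * k)%R by (repeat apply Rmult_lt_0_compat; lra). nra. }
  intros y Hy.
  assert (Hy1 := Rlt_le_trans _ _ _ Hy (Rmin_l _ _)).
  assert (Hy2 := Rlt_le_trans _ _ _ Hy (Rmin_r _ _)).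
  assert (Ht := Cmod_triangle y (z - y)).
  replace (y + (z - y)) with z in Ht by ring. fold k in Ht.
  replace (Cmod (z - y)) with (Cmod (y - z)) in Ht
    by (rewrite <- Cmod_opp; f_equal; ring).
  assert (Hyk : (k / 2 < Cmod y)%R) by lra.
  assert (Hyn : y <> RtoC 0) by (apply Cmod_gt_0; lra).
  replace (/ y - / z - - / (z * z) * (y - z)) with ((y - z) * (y - z) / (z * z * y))
    by (field; auto).
  assert (z * z * y <> RtoC 0) by (repeat apply Cmult_neq_0; auto).
  rewrite Cmod_div by auto. rewrite !Cmod_mult. fold k.
  set (Y := Cmod (y - z)) in *. assert (0 <= Y)%R by apply Cmod_ge_0.
  assert (0 < k * k)%R by nra.
  assert (HD : (k * k * (k / 2) < k * k * Cmod y)%R) by (apply Rmult_lt_compat_l; lra).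
  assert (0 < k * k * (k / 2))%R by nra.
  apply (Rmult_le_reg_r (k * k * Cmod y)); [lra|].
  unfold Rdiv at 1. rewrite Rmult_assoc, Rinv_l, Rmult_1_r by lra.
  assert (Y * Y <= eps * Y * (k * k * (k / 2)))%R.
  { replace (eps * Y * (k * k * (k / 2)))%R with (Y * (eps * (k * k * k) / 2))%R by field.
    apply Rmult_le_compat_l; lra. }
  assert (0 <= eps * Y)%R by nra. nra.
Qed.

Lemma Cderiv_comp (f g : C -> C) (z a b : C) :
  Cderiv f (g z) a -> Cderiv g z b -> Cderiv (fun x => f (g x)) z (b * a).
Proof.
  intros Hf Hg.
  (* The chain rule wants the inner derivative over [AbsRing_NormedModule C_AbsRing]. The estimate
     is convertible; only the linearity half is proved again. *)
  assert (Hg' : is_derive (K := C_AbsRing) (V := AbsRing_NormedModule C_AbsRing) g z b).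
  { destruct Hg as [_ Hg]. split; [apply is_linear_scal_l | exact Hg]. }
  exact (is_derive_comp (K := C_AbsRing) (V := C_NormedModule) f g z a b Hf Hg').
Qed.

Lemma Cderiv_inv (f : C -> C) (z a : C) :
  f z <> RtoC 0 -> Cderiv f z a -> Cderiv (fun x => / f x) z (- a / (f z * f z)).
Proof.
  intros Hz Hf. eapply Cderiv_eq.
  - apply (Cderiv_comp (fun x => / x) f); [apply Cderiv_inv_id; exact Hz | exact Hf].
  - field; auto.
Qed.

Lemma Cderiv_shift (f : C -> C) (c z a : C) :
  Cderiv f (c + z) a -> Cderiv (fun x => f (c + x)) z a.
Proof.
  intros Hf. eapply Cderiv_eq.
  - apply (Cderiv_comp f (fun x => c + x)); [exact Hf|].
    apply Cderiv_plus; [apply Cderiv_const | apply Cderiv_id].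
  - ring.
Qed.

(** * Goursat's theorem for closed real 1-forms *)

Open Scope R_scope.

(* The form [p dx + q dy] is differentiable at [(x, y)] and closed there: [m] is both
   the [y]-derivative of [p] and the [x]-derivative of [q]. *)
Definition closed_form_at (p q : R -> R -> R) (x y : R) : Prop :=
  exists px m qy : R, forall eps, 0 < eps -> exists delta, 0 < delta /\
    forall x' y', Rabs (x' - x) < delta -> Rabs (y' - y) < delta ->
      Rabs (p x' y' - p x y - (px * (x' - x) + m * (y' - y)))
        <= eps * (Rabs (x' - x) + Rabs (y' - y)) /\
      Rabs (q x' y' - q x y - (m * (x' - x) + qy * (y' - y)))
        <= eps * (Rabs (x' - x) + Rabs (y' - y)).

(** The counterclockwise line integral of [p dx + q dy] around the rectangle. Opposite sides share
    one integral, so that cutting the rectangle amounts to telescoping the integrands. *)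
Definition boundary_integral (p q : R -> R -> R) (a b c d : R) : R :=
  RInt (fun x => p x c - p x d) a b + RInt (fun y => q b y - q a y) c d.

Lemma closed_form_continuous (p q : R -> R -> R) (x y : R) :
  closed_form_at p q x y ->
  (continuous (fun t => p t y) x /\ continuous (fun t => q x t) y).
Proof.
  intros (px & m & qy & H).
  destruct (H 1 Rlt_0_1) as [d [Hd H']].
  assert (Hpx := Rabs_pos px). assert (Hqy := Rabs_pos qy).
  split.
  - apply continuity_pt_filterlim. intros e He.
    exists (Rmin d (e / (2 + Rabs px))). split.
    { apply Rmin_pos; [lra|]. apply Rdiv_lt_0_compat; lra. }
    intros t [_ Ht]. simpl in *. unfold R_dist in *.
    assert (Ht1 := Rlt_le_trans _ _ _ Ht (Rmin_l _ _)).
    assert (Ht2 := Rlt_le_trans _ _ _ Ht (Rmin_r _ _)).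
    destruct (H' t y Ht1) as [A _].
    { rewrite Rminus_diag, Rabs_R0; lra. }
    rewrite Rminus_diag, Rabs_R0 in A.
    replace (p t y - p x y) with
      ((p t y - p x y - (px * (t - x) + m * 0)) + px * (t - x)) by ring.
    eapply Rle_lt_trans; [apply Rabs_triang|]. rewrite Rabs_mult.
    assert (Rabs (t - x) * (2 + Rabs px) < e).
    { apply (Rmult_lt_reg_r (/ (2 + Rabs px))); [apply Rinv_0_lt_compat; lra|].
      rewrite Rmult_assoc, Rinv_r by lra. rewrite Rmult_1_r. exact Ht2. }
    assert (0 <= Rabs (t - x)) by apply Rabs_pos. nra.
  - apply continuity_pt_filterlim. intros e He.
    exists (Rmin d (e / (2 + Rabs qy))). split.
    { apply Rmin_pos; [lra|]. apply Rdiv_lt_0_compat; lra. }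
    intros t [_ Ht]. simpl in *. unfold R_dist in *.
    assert (Ht1 := Rlt_le_trans _ _ _ Ht (Rmin_l _ _)).
    assert (Ht2 := Rlt_le_trans _ _ _ Ht (Rmin_r _ _)).
    destruct (H' x t) as [_ A].
    { rewrite Rminus_diag, Rabs_R0; lra. }
    { exact Ht1. }
    rewrite Rminus_diag, Rabs_R0 in A.
    replace (q x t - q x y) with
      ((q x t - q x y - (m * 0 + qy * (t - y))) + qy * (t - y)) by ring.
    eapply Rle_lt_trans; [apply Rabs_triang|]. rewrite Rabs_mult.
    assert (Rabs (t - y) * (2 + Rabs qy) < e).
    { apply (Rmult_lt_reg_r (/ (2 + Rabs qy))); [apply Rinv_0_lt_compat; lra|].
      rewrite Rmult_assoc, Rinv_r by lra. rewrite Rmult_1_r. exact Ht2. }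
    assert (0 <= Rabs (t - y)) by apply Rabs_pos. nra.
Qed.

Lemma closed_form_ex_RInt_x (p q : R -> R -> R) (a b y : R) : a <= b ->
  (forall x, a <= x <= b -> closed_form_at p q x y) ->
  ex_RInt (fun x => p x y) a b.
Proof.
  intros Hab H. apply (ex_RInt_continuous (V := R_CompleteNormedModule)).
  rewrite Rmin_left, Rmax_right by lra.
  intros z Hz. apply (closed_form_continuous p q z y (H z Hz)).
Qed.

Lemma closed_form_ex_RInt_y (p q : R -> R -> R) (c d x : R) : c <= d ->
  (forall y, c <= y <= d -> closed_form_at p q x y) ->
  ex_RInt (fun y => q x y) c d.
Proof.
  intros Hab H. apply (ex_RInt_continuous (V := R_CompleteNormedModule)).
  rewrite Rmin_left, Rmax_right by lra.
  intros z Hz. apply (closed_form_continuous p q x z (H z Hz)).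
Qed.

Lemma RInt_diff_Chasles (f g : R -> R) (a m b : R) : a <= m <= b ->
  ex_RInt f a b -> ex_RInt g a b ->
  RInt (fun x => f x - g x) a b
    = RInt (fun x => f x - g x) a m + RInt (fun x => f x - g x) m b.
Proof.
  intros Hm Hf Hg. symmetry.
  assert (H := ex_RInt_minus f g a b Hf Hg).
  apply (RInt_Chasles (V := R_CompleteNormedModule)).
  - apply (ex_RInt_Chasles_1 (V := R_CompleteNormedModule)) with b; [lra | exact H].
  - apply (ex_RInt_Chasles_2 (V := R_CompleteNormedModule)) with a; [lra | exact H].
Qed.

Lemma RInt_diff_telescope (f g h : R -> R) (a b : R) :
  ex_RInt f a b -> ex_RInt g a b -> ex_RInt h a b ->
  RInt (fun x => f x - h x) a b
    = RInt (fun x => f x - g x) a b + RInt (fun x => g x - h x) a b.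
Proof.
  intros Hf Hg Hh.
  rewrite (RInt_minus f h), (RInt_minus f g), (RInt_minus g h) by assumption.
  unfold minus, plus, opp; simpl. ring.
Qed.

(** The common side [x = m] is traversed once upwards and once downwards, so its two contributions
    cancel. *)
Lemma boundary_integral_split_x (p q : R -> R -> R) (a m b c d : R) :
  a <= m <= b ->
  ex_RInt (fun x => p x c) a b -> ex_RInt (fun x => p x d) a b ->
  ex_RInt (fun y => q a y) c d -> ex_RInt (fun y => q m y) c d ->
  ex_RInt (fun y => q b y) c d ->
  boundary_integral p q a b c d
    = boundary_integral p q a m c d + boundary_integral p q m b c d.
Proof.
  intros Hm H1 H2 H3 H4 H5. unfold boundary_integral.
  rewrite (RInt_diff_Chasles _ _ a m b Hm H1 H2).
  rewrite (RInt_diff_telescope _ _ _ c d H5 H4 H3). ring.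
Qed.

Lemma boundary_integral_split_y (p q : R -> R -> R) (a b c m d : R) :
  c <= m <= d ->
  ex_RInt (fun x => p x c) a b -> ex_RInt (fun x => p x m) a b ->
  ex_RInt (fun x => p x d) a b ->
  ex_RInt (fun y => q a y) c d -> ex_RInt (fun y => q b y) c d ->
  boundary_integral p q a b c d
    = boundary_integral p q a b c m + boundary_integral p q a b m d.
Proof.
  intros Hm H1 H2 H3 H4 H5. unfold boundary_integral.
  rewrite (RInt_diff_Chasles _ _ c m d Hm H5 H4).
  rewrite (RInt_diff_telescope _ _ _ a b H1 H2 H3). ring.
Qed.

Lemma RInt_near_const (f : R -> R) (a b k e : R) : a <= b -> ex_RInt f a b ->
  (forall x, a <= x <= b -> Rabs (f x - k) <= e) ->
  Rabs (RInt f a b - k * (b - a)) <= e * (b - a).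
Proof.
  intros Hab Hf H.
  assert (Hk : ex_RInt (fun _ : R => k) a b) by apply (ex_RInt_const (V := R_CompleteNormedModule)).
  assert (E : RInt (fun x => f x - k) a b = RInt f a b - k * (b - a)).
  { rewrite (RInt_minus f (fun _ => k)) by assumption.
    rewrite (RInt_const (V := R_CompleteNormedModule)).
    unfold minus, plus, opp, scal; simpl. unfold mult; simpl. ring. }
  rewrite <- E, Rmult_comm. apply abs_RInt_le_const; [exact Hab | | exact H].
  apply (ex_RInt_minus f (fun _ => k)); assumption.
Qed.

Section Bisection.

Variables p q : R -> R -> R.

Definition rect : Type := ((R * R) * (R * R))%type.

Let J (r : rect) : R :=
  boundary_integral p q (fst (fst r)) (snd (fst r)) (fst (snd r)) (snd (snd r)).

(** The last quadrant is taken untested: the four integrals add up to [J r], so it reaches a quarter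
    of [Rabs (J r)] when the other three do not. *)
Definition bisect (r : rect) : rect :=
  let a := fst (fst r) in let b := snd (fst r) in
  let c := fst (snd r) in let d := snd (snd r) in
  let m := (a + b) / 2 in let n := (c + d) / 2 in
  let bound := Rabs (J r) / 4 in
  if Rle_dec bound (Rabs (J ((a, m), (c, n)))) then ((a, m), (c, n))
  else if Rle_dec bound (Rabs (J ((m, b), (c, n)))) then ((m, b), (c, n))
  else if Rle_dec bound (Rabs (J ((a, m), (n, d)))) then ((a, m), (n, d))
  else ((m, b), (n, d)).

Fixpoint bisections (r : rect) (n : nat) : rect :=
  match n with O => r | S k => bisect (bisections r k) end.

(** The ordering of the endpoints of [s] is included, so [subrect r r] says that [r] is a genuine,
    possibly degenerate, rectangle. *)
Definition subrect (s r : rect) : Prop :=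
  (fst (fst r) <= fst (fst s) <= snd (fst s) /\ snd (fst s) <= snd (fst r)) /\
  (fst (snd r) <= fst (snd s) <= snd (snd s) /\ snd (snd s) <= snd (snd r)).

Definition closed_form_on (r : rect) : Prop := forall x y,
  fst (fst r) <= x <= snd (fst r) -> fst (snd r) <= y <= snd (snd r) ->
  closed_form_at p q x y.

Lemma bisect_spec (r : rect) : subrect r r -> closed_form_on r ->
  subrect (bisect r) r /\
  snd (fst (bisect r)) - fst (fst (bisect r)) = (snd (fst r) - fst (fst r)) / 2 /\
  snd (snd (bisect r)) - fst (snd (bisect r)) = (snd (snd r) - fst (snd r)) / 2 /\
  Rabs (J r) / 4 <= Rabs (J (bisect r)).
Proof.
  destruct r as [[a b] [c d]]. unfold subrect, closed_form_on. simpl.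
  intros [[Ha _] [Hc _]] H.
  set (m := (a + b) / 2). set (n := (c + d) / 2).
  assert (Hm : a <= m <= b) by (unfold m; lra).
  assert (Hn : c <= n <= d) by (unfold n; lra).
  assert (Ex : forall u v y, a <= u <= v -> v <= b -> c <= y <= d -> ex_RInt (fun x => p x y) u v).
  { intros. apply closed_form_ex_RInt_x with q; [lra|]. intros; apply H; lra. }
  assert (Ey : forall u v x, c <= u <= v -> v <= d -> a <= x <= b -> ex_RInt (fun y => q x y) u v).
  { intros. apply closed_form_ex_RInt_y with p; [lra|]. intros; apply H; lra. }
  assert (E : J ((a, b), (c, d)) = J ((a, m), (c, n)) + J ((m, b), (c, n))
     + J ((a, m), (n, d)) + J ((m, b), (n, d))).
  { unfold J; simpl.
    rewrite (boundary_integral_split_y p q a b c n d), (boundary_integral_split_x p q a m b c n),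
      (boundary_integral_split_x p q a m b n d);
      try match goal with
      | |- ex_RInt (fun x => p x _) _ _ => apply Ex
      | |- ex_RInt (fun y => q _ y) _ _ => apply Ey
      end; try lra.
    }
  unfold bisect; simpl. fold m n.
  repeat destruct Rle_dec; simpl;
    (split; [lra | split; [unfold m; lra | split; [unfold n; lra |]]]); auto.
  apply Rnot_le_lt in n0, n1, n2.
  assert (T1 := Rabs_triang (J ((a, m), (c, n)) + J ((m, b), (c, n)) + J ((a, m), (n, d))) (J ((m, b), (n, d)))).
  assert (T2 := Rabs_triang (J ((a, m), (c, n)) + J ((m, b), (c, n))) (J ((a, m), (n, d)))).
  assert (T3 := Rabs_triang (J ((a, m), (c, n))) (J ((m, b), (c, n)))).
  rewrite <- E in T1. lra.
Qed.

Lemma bisections_spec (r : rect) : subrect r r -> closed_form_on r -> forall n,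
  subrect (bisections r n) r /\
  snd (fst (bisections r n)) - fst (fst (bisections r n)) = (snd (fst r) - fst (fst r)) / 2 ^ n /\
  snd (snd (bisections r n)) - fst (snd (bisections r n)) = (snd (snd r) - fst (snd r)) / 2 ^ n /\
  Rabs (J r) / 4 ^ n <= Rabs (J (bisections r n)).
Proof.
  intros Hr H. induction n as [|n IH].
  - simpl. repeat split; try apply Hr; lra.
  - destruct IH as (S1 & L1 & K1 & J1).
    set (s := bisections r n) in *.
    change (bisections r (S n)) with (bisect s).
    destruct (bisect_spec s) as (S2 & L2 & K2 & J2).
    + unfold subrect in *; lra.
    + intros x y Hx Hy. apply H; unfold subrect in S1; lra.
    + assert (2 ^ n <> 0) by (apply pow_nonzero; lra).
      assert (4 ^ n <> 0) by (apply pow_nonzero; lra).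
      split; [unfold subrect in *; lra|].
      rewrite L2, K2, L1, K1. simpl. split; [field; lra|]. split; [field; lra|].
      replace (Rabs (J r) / (4 * 4 ^ n)) with (Rabs (J r) / 4 ^ n / 4) by (field; lra).
      lra.
Qed.

Lemma bisections_decr (r : rect) (n k : nat) : subrect r r -> closed_form_on r ->
  subrect (bisections r (k + n)) (bisections r n).
Proof.
  intros Hr H. induction k as [|k IH].
  - destruct (bisections_spec r Hr H n) as (S1 & _). unfold subrect in *; simpl; lra.
  - destruct (bisections_spec r Hr H (k + n)) as (S1 & _).
    destruct (bisect_spec (bisections r (k + n))) as (S2 & _).
    + unfold subrect in *; lra.
    + intros x y Hx Hy. apply H; unfold subrect in *; lra.
    + change (bisections r (S k + n)) with (bisect (bisections r (k + n))).
      unfold subrect in *; lra.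
Qed.

Lemma nested_intervals (u v : nat -> R) :
  (forall n k, u n <= u (k + n)%nat <= v (k + n)%nat /\ v (k + n)%nat <= v n) ->
  exists x, forall n, u n <= x <= v n.
Proof.
  intros H.
  (* Both ends are compared at the common later index [n + m]; the supremum of the left ends then
     lies in every interval. *)
  assert (H' : forall n m, u n <= v m).
  { intros n m. assert (A := H n m). assert (B := H m n).
    rewrite (Nat.add_comm n m) in B. lra. }
  destruct (completeness (fun t => exists n, t = u n)) as [x [X1 X2]].
  - exists (v 0%nat). intros t [n ->]. apply H'.
  - exists (u 0%nat). now exists 0%nat.
  - exists x. intros n. split.
    + apply X1. now exists n.
    + apply X2. intros t [k ->]. apply H'.
Qed.

(** The selected rectangles shrink to a point. Differentiability there makes the form affine up to
    [eps * l], where [l] is the current half-perimeter, so the integral is at most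
    [2 * eps * l * l]. Since [l] is halved at each step, this decreases by the same factor [4] that
    bisection may lose, and [J r] is bounded by a multiple of [eps]. *)
Lemma Goursat (a b c d : R) : a <= b -> c <= d ->
  (forall x y, a <= x <= b -> c <= y <= d -> closed_form_at p q x y) ->
  boundary_integral p q a b c d = 0.
Proof.
  intros Hab Hcd H.
  set (r := ((a, b), (c, d)) : rect).
  assert (Hr : subrect r r) by (unfold subrect; simpl; lra).
  assert (HH : closed_form_on r) by exact H.
  set (s := bisections r).
  destruct (nested_intervals (fun n => fst (fst (s n))) (fun n => snd (fst (s n)))) as [x0 Hx0].
  { intros n k. destruct (bisections_decr r n k Hr HH) as [A _]. exact A. }
  destruct (nested_intervals (fun n => fst (snd (s n))) (fun n => snd (snd (s n)))) as [y0 Hy0].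
  { intros n k. destruct (bisections_decr r n k Hr HH) as [_ A]. exact A. }
  assert (Hpt : closed_form_at p q x0 y0).
  { apply H; [exact (Hx0 0%nat) | exact (Hy0 0%nat)]. }
  set (L := (b - a) + (d - c)).
  assert (HL : 0 <= L) by (unfold L; lra).
  assert (Hsmall : forall eps, 0 < eps -> Rabs (J r) <= 2 * eps * (L * L)).
  { intros eps He. destruct Hpt as (px & m & qy & Hp).
    destruct (Hp eps He) as [delta [Hd Hloc]].
    destruct (pow_lt_1_zero (/ 2)) with (y := delta / (L + 1)) as [N HN].
    { rewrite Rabs_right; lra. }
    { apply Rdiv_lt_0_compat; lra. }
    specialize (HN N (Nat.le_refl N)).
    assert (H2N : 0 < 2 ^ N) by (apply pow_lt; lra).
    rewrite pow_inv, Rabs_right in HN by (left; apply Rinv_0_lt_compat; lra).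
    destruct (bisections_spec r Hr HH N) as (S1 & L1 & K1 & J1).
    fold s in S1, L1, K1, J1. simpl in L1, K1, J1.
    assert (HNx := Hx0 N). assert (HNy := Hy0 N). unfold subrect in S1. simpl in S1, HNx, HNy.
    unfold J in J1 at 2.
    set (a' := fst (fst (s N))) in *. set (b' := snd (fst (s N))) in *.
    set (c' := fst (snd (s N))) in *. set (d' := snd (snd (s N))) in *.
    assert (HLs : (b' - a') + (d' - c') = L / 2 ^ N) by (unfold L; rewrite L1, K1; field; lra).
    set (l := L / 2 ^ N) in *.
    assert (Hl0 : 0 <= l) by lra.
    assert (Hld : l < delta).
    { unfold l, Rdiv.
      assert (/ 2 ^ N * (L + 1) < delta).
      { apply (Rmult_lt_reg_r (/ (L + 1))); [apply Rinv_0_lt_compat; lra|].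
        rewrite Rmult_assoc, Rinv_r by lra. rewrite Rmult_1_r. exact HN. }
      assert (0 < / 2 ^ N) by (apply Rinv_0_lt_compat; lra). nra. }
    assert (Hin : forall x y, a' <= x <= b' -> c' <= y <= d' ->
      Rabs (p x y - p x0 y0 - (px * (x - x0) + m * (y - y0))) <= eps * l /\
      Rabs (q x y - q x0 y0 - (m * (x - x0) + qy * (y - y0))) <= eps * l).
    { intros x y Hx Hy.
      assert (Ax : Rabs (x - x0) <= b' - a') by (apply Rabs_le; lra).
      assert (Ay : Rabs (y - y0) <= d' - c') by (apply Rabs_le; lra).
      destruct (Hloc x y) as [B1 B2]; [lra|lra|].
      split; (eapply Rle_trans; [eassumption|]); apply Rmult_le_compat_l; lra. }
    (* The affine part of [p] changes by the constant [m * (c' - d')] between bottom and top, that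
       of [q] by [m * (b' - a')] between left and right. As [m] is the same coefficient, the two
       main terms cancel in [I3]. *)
    assert (I1 : Rabs (RInt (fun x => p x c' - p x d') a' b' - (m * (c' - d')) * (b' - a'))
       <= (2 * eps * l) * (b' - a')).
    { apply RInt_near_const; [lra| |].
      - apply (ex_RInt_minus (fun x => p x c') (fun x => p x d'));
          apply closed_form_ex_RInt_x with q; try lra; intros; apply H; lra.
      - intros x Hx. destruct (Hin x c') as [B1 _]; [lra|lra|]. destruct (Hin x d') as [B2 _]; [lra|lra|].
        apply Rabs_le. apply Rabs_le_between in B1. apply Rabs_le_between in B2. lra. }
    assert (I2 : Rabs (RInt (fun y => q b' y - q a' y) c' d' - (m * (b' - a')) * (d' - c'))
       <= (2 * eps * l) * (d' - c')).
    { apply RInt_near_const; [lra| |].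
      - apply (ex_RInt_minus (fun y => q b' y) (fun y => q a' y));
          apply closed_form_ex_RInt_y with p; try lra; intros; apply H; lra.
      - intros y Hy. destruct (Hin b' y) as [_ B1]; [lra|lra|]. destruct (Hin a' y) as [_ B2]; [lra|lra|].
        apply Rabs_le. apply Rabs_le_between in B1. apply Rabs_le_between in B2. lra. }
    assert (I3 : Rabs (boundary_integral p q a' b' c' d') <= 2 * eps * l * l).
    { unfold boundary_integral.
      replace (2 * eps * l * l) with (2 * eps * l * (b' - a') + 2 * eps * l * (d' - c'))
        by (rewrite <- HLs; ring).
      apply Rabs_le. apply Rabs_le_between in I1. apply Rabs_le_between in I2. lra. }
    assert (H4 : 4 ^ N = 2 ^ N * 2 ^ N).
    { replace 4 with (2 * 2) by ring. apply Rpow_mult_distr. }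
    assert (E : 2 * eps * l * l = 2 * eps * (L * L) / 4 ^ N) by (unfold l; rewrite H4; field; lra).
    assert (0 < 4 ^ N) by (apply pow_lt; lra).
    apply (Rmult_le_reg_r (/ 4 ^ N)); [apply Rinv_0_lt_compat; lra|].
    unfold Rdiv in *. lra. }
  change (J r = 0).
  destruct (Req_dec (J r) 0) as [|Hne]; [assumption|exfalso].
  assert (Hpos := Rabs_pos_lt _ Hne).
  (* This [eps] makes the bound smaller than [Rabs (J r) / 2]; the [+ 1] covers [L = 0]. *)
  assert (HX := Hsmall (Rabs (J r) / (4 * (L * L + 1)))).
  assert (0 <= L * L) by nra.
  assert (0 < Rabs (J r) / (4 * (L * L + 1))) by (apply Rdiv_lt_0_compat; lra).
  specialize (HX H1).
  assert (E : 2 * (Rabs (J r) / (4 * (L * L + 1))) * (L * L)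
    = Rabs (J r) / 2 - Rabs (J r) / (2 * (L * L + 1))) by (field; lra).
  assert (0 < Rabs (J r) / (2 * (L * L + 1))) by (apply Rdiv_lt_0_compat; lra).
  lra.
Qed.

End Bisection.

(** * Estimates on squares *)

(** The region between the squares is cut into two full-height strips on the left and right and two
    blocks below and above the inner square; Goursat's theorem removes all four. *)
Lemma boundary_integral_square_shrink (p q : R -> R -> R) (a e : R) : 0 < e <= a ->
  (forall x y, -a <= x <= a -> -a <= y <= a ->
     (x <= -e \/ e <= x) \/ (y <= -e \/ e <= y) -> closed_form_at p q x y) ->
  boundary_integral p q (-a) a (-a) a = boundary_integral p q (-e) e (-e) e.
Proof.
  intros He H.
  assert (Ex : forall u v y, -a <= u <= v -> v <= a -> -a <= y <= a -> (y <= -e \/ e <= y) ->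
    ex_RInt (fun x => p x y) u v).
  { intros. apply closed_form_ex_RInt_x with q; [lra|]. intros; apply H; lra. }
  assert (Ey : forall u v x, -a <= u <= v -> v <= a -> -a <= x <= a -> (x <= -e \/ e <= x) ->
    ex_RInt (fun y => q x y) u v).
  { intros. apply closed_form_ex_RInt_y with p; [lra|]. intros; apply H; lra. }
  rewrite (boundary_integral_split_x p q (-a) (-e) a (-a) a),
    (boundary_integral_split_x p q (-e) e a (-a) a),
    (boundary_integral_split_y p q (-e) e (-a) (-e) a),
    (boundary_integral_split_y p q (-e) e (-e) e a);
      try match goal with
      | |- ex_RInt (fun x => p x _) _ _ => apply Ex
      | |- ex_RInt (fun y => q _ y) _ _ => apply Ey
      end; try lra.
  rewrite (Goursat p q (-a) (-e) (-a) a), (Goursat p q e a (-a) a),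
    (Goursat p q (-e) e (-a) (-e)), (Goursat p q (-e) e e a);
    try (intros; apply H); lra.
Qed.

(** The form is [Im (f dz)]. The Cauchy-Riemann equations are its closedness: multiplication by [l]
    gives [Re l] both as the [y]-derivative of [Im f] and as the [x]-derivative of [Re f]. *)
Lemma Cderiv_closed_form (f : C -> C) (x y : R) (l : C) : Cderiv f (x, y) l ->
  closed_form_at (fun x y => Im (f (x, y))) (fun x y => Re (f (x, y))) x y.
Proof.
  intros H. exists (Im l), (Re l), (- Im l). intros eps He.
  destruct (proj1 (Cderiv_iff f (x, y) l) H eps He) as [d [Hd Hl]].
  exists (d / 2). split; [lra|]. intros x' y' Hx Hy.
  assert (Hm : Cmod ((x', y') - (x, y))%C <= Rabs (x' - x) + Rabs (y' - y)).
  { replace ((x', y') - (x, y))%C with (RtoC (x' - x) + Ci * RtoC (y' - y))%C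
      by (apply injective_projections; simpl; ring).
    eapply Rle_trans; [apply Cmod_triangle|].
    rewrite Cmod_mult, Cmod_Ci, !Cmod_R. lra. }
  specialize (Hl (x', y') ltac:(lra)).
  set (V := (f (x', y') - f (x, y) - l * ((x', y') - (x, y)))%C) in Hl.
  assert (B : Cmod V <= eps * (Rabs (x' - x) + Rabs (y' - y))).
  { eapply Rle_trans; [exact Hl|]. apply Rmult_le_compat_l; lra. }
  split; (eapply Rle_trans; [|exact B]).
  - replace (_ - _) with (snd V) by (unfold V; simpl; unfold Re, Im; ring).
    eapply Rle_trans; [apply Rmax_r | apply Rmax_Cmod].
  - replace (_ - _) with (fst V) by (unfold V; simpl; unfold Re, Im; ring).
    eapply Rle_trans; [apply Rmax_l | apply Rmax_Cmod].
Qed.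

Definition Csup (z : C) : R := Rmax (Rabs (fst z)) (Rabs (snd z)).

Lemma Csup_le_Cmod (z : C) : Csup z <= Cmod z.
Proof. apply Rmax_Cmod. Qed.

Lemma Cmod_le_Csup (z : C) : Cmod z <= 2 * Csup z.
Proof.
  eapply Rle_trans; [apply Cmod_2Rmax|]. apply Rmult_le_compat_r.
  - eapply Rle_trans; [apply Rabs_pos | apply Rmax_l].
  - rewrite <- (sqrt_square 2) at 2 by lra. apply sqrt_le_1; lra.
Qed.

Lemma Cmod2_le_Csup2 (z : C) : Cmod z ^ 2 <= 2 * Csup z ^ 2.
Proof.
  rewrite Cmod2_alt. unfold Csup, Re, Im.
  assert (A := Rmax_l (Rabs (fst z)) (Rabs (snd z))).
  assert (B := Rmax_r (Rabs (fst z)) (Rabs (snd z))).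
  assert (A' := Rabs_pos (fst z)). assert (B' := Rabs_pos (snd z)).
  rewrite <- (pow2_abs (fst z)), <- (pow2_abs (snd z)). nra.
Qed.

Lemma Csup_pair (x y a : R) : -a <= x <= a -> -a <= y <= a -> Csup (x, y) <= a.
Proof. intros. apply Rmax_lub; simpl; apply Rabs_le; lra. Qed.

Lemma Csup_side (x y a : R) : 0 <= a -> -a <= x <= a -> -a <= y <= a ->
  Rabs x = a \/ Rabs y = a -> Csup (x, y) = a.
Proof.
  intros Ha Hx Hy H. apply Rle_antisym; [now apply Csup_pair|].
  unfold Csup; simpl. destruct H as [<-| <-]; [apply Rmax_l | apply Rmax_r].
Qed.

Lemma Re_le_Cmod (z : C) : Re z <= Cmod z.
Proof. eapply Rle_trans; [apply Rle_abs | apply re_le_Cmod]. Qed.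

(* [e] is the unit for which [Re (e Q)] is the integrand of [Im (Q dz)] on a side of the
   square, traversed counterclockwise. *)
Lemma side_integrand_le (g e z : C) (k a M : R) : 0 < a -> 0 <= k ->
  Csup z = a -> Cmod e = 1 -> Re (e * Cconj z) = a -> Cmod g <= M ->
  Re (e * ((g - RtoC k) / z)) <= M / a - k / (2 * a).
Proof.
  intros Ha Hk Hz He Hez Hg.
  assert (Hza : a <= Cmod z) by (rewrite <- Hz; apply Csup_le_Cmod).
  assert (Hz2 : Cmod z ^ 2 <= 2 * a ^ 2) by (rewrite <- Hz; apply Cmod2_le_Csup2).
  assert (Hz0 : z <> RtoC 0) by (apply Cmod_gt_0; lra).
  assert (HI : (/ z = Cconj z * RtoC (/ Cmod z ^ 2))%C).
  { rewrite RtoC_inv, Cmod2_conj by (apply pow_nonzero; lra).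
    assert (Cconj z <> RtoC 0) by (intros E; apply Hz0; rewrite <- (Cconj_conj z), E; apply injective_projections; simpl; ring).
    field; auto. }
  replace (e * ((g - RtoC k) / z))%C with (e * (g / z) - RtoC k * (e * / z))%C by (field; auto).
  assert (H1 : Re (e * (g / z)) <= M / a).
  { eapply Rle_trans; [apply Re_le_Cmod|]. rewrite Cmod_mult, He, Cmod_div by auto.
    rewrite Rmult_1_l. unfold Rdiv. apply Rmult_le_compat; auto using Cmod_ge_0.
    - left; apply Rinv_0_lt_compat; lra.
    - apply Rinv_le_contravar; lra. }
  assert (H2 : Re (e * / z) = a * / Cmod z ^ 2).
  { rewrite HI, Cmult_assoc, <- Hez. unfold Re; simpl; ring. }
  assert (H3 : / (2 * a) <= a * / Cmod z ^ 2).
  { assert (0 < Cmod z ^ 2) by (apply pow_lt; lra).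
    replace (/ (2 * a)) with (a * / (2 * a ^ 2)) by (field; lra).
    apply Rmult_le_compat_l; [lra|]. apply Rinv_le_contravar; lra. }
  replace (Re (e * (g / z) - RtoC k * (e * / z))) with (Re (e * (g / z)) - k * Re (e * / z))
    by (unfold Re; simpl; ring).
  rewrite H2. unfold Rdiv at 2. nra.
Qed.

(** The form [Im ((g - k) / z dz)] is closed away from [0]. Its integral over the square is at most
    [8 * M - 4 * k], since each of four sides of length [2 * a] has integrand at most
    [M / a - k / (2 * a)]. Shrinking the square shows that the integral is not negative. *)
Lemma center_le_boundary_real (g : C -> C) (a k M : R) : 0 < a -> 0 <= k ->
  g (RtoC 0) = RtoC k ->
  (forall z, Csup z <= a -> z <> RtoC 0 -> exists l, Cderiv g z l) ->
  (forall eps, 0 < eps -> exists delta, 0 < delta /\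
     forall z, Cmod z < delta -> Cmod (g z - g (RtoC 0)) <= eps) ->
  (forall z, Csup z = a -> Cmod (g z) <= M) ->
  k <= 2 * M.
Proof.
  intros Ha Hk Hg0 Hd Hc HM.
  set (Q := fun z => ((g z - RtoC k) / z)%C).
  set (p := fun x y => Im (Q (x, y))). set (q := fun x y => Re (Q (x, y))).
  assert (Hcl : forall x y, -a <= x <= a -> -a <= y <= a -> (x, y) <> RtoC 0 -> closed_form_at p q x y).
  { intros x y Hx Hy Hz.
    destruct (Hd (x, y) (Csup_pair x y a Hx Hy) Hz) as [l Hl].
    eapply Cderiv_closed_form. unfold Q, Cdiv.
    apply Cderiv_mult; [apply Cderiv_minus; [exact Hl | apply Cderiv_const] |].
    apply Cderiv_inv_id. exact Hz. }
  assert (Hne : forall x y, x <> 0 \/ y <> 0 -> (x, y) <> RtoC 0).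
  { intros x y H E. injection E. intros. lra. }
  assert (Hxy : forall e x y, 0 < e <= a -> -a <= x <= a -> -a <= y <= a ->
    (x <= -e \/ e <= x) \/ (y <= -e \/ e <= y) -> closed_form_at p q x y).
  { intros e x y He Hx Hy H. apply Hcl; auto. apply Hne.
    destruct H as [[H|H]|[H|H]]; [left|left|right|right]; lra. }
  assert (Ex : forall e y, 0 < e <= a -> (y = -e \/ y = e) -> ex_RInt (fun x => p x y) (-e) e).
  { intros e y He Hy. apply closed_form_ex_RInt_x with q; [lra|].
    intros x Hx. apply (Hxy e); lra. }
  assert (Ey : forall e x, 0 < e <= a -> (x = -e \/ x = e) -> ex_RInt (fun y => q x y) (-e) e).
  { intros e x He Hx. apply closed_form_ex_RInt_y with p; [lra|].
    intros y Hy. apply (Hxy e); lra. }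
  assert (Hup : boundary_integral p q (-a) a (-a) a <= 8 * M - 4 * k).
  { unfold boundary_integral. set (B := M / a - k / (2 * a)).
    assert (EB : (2 * B) * (a - - a) + (2 * B) * (a - - a) = 8 * M - 4 * k)
      by (unfold B; field; lra).
    assert (Hc2 : forall f, ex_RInt f (-a) a -> (forall t, -a < t < a -> f t <= 2 * B) ->
      RInt f (-a) a <= 2 * B * (a - - a)).
    { intros f Hf Hle. replace (2 * B * (a - - a)) with (RInt (fun _ => 2 * B) (-a) a).
      - apply RInt_le; auto; [lra|]. apply (ex_RInt_const (V := R_CompleteNormedModule)).
      - rewrite (RInt_const (V := R_CompleteNormedModule)). unfold scal; simpl. unfold mult; simpl. ring. }
    rewrite <- EB. apply Rplus_le_compat; apply Hc2.
    - apply (ex_RInt_minus (fun x => p x (-a)) (fun x => p x a)); apply Ex; lra.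
    - intros t Ht.
      assert (Hs1 : Csup (t, -a) = a) by (apply Csup_side; try lra; right; rewrite Rabs_Ropp; apply Rabs_right; lra).
      assert (Hs2 : Csup (t, a) = a) by (apply Csup_side; try lra; right; apply Rabs_right; lra).
      assert (A1 := side_integrand_le (g (t, -a)) (- Ci)%C (t, -a) k a M Ha Hk Hs1).
      assert (A2 := side_integrand_le (g (t, a)) Ci (t, a) k a M Ha Hk Hs2).
      rewrite Cmod_opp, Cmod_Ci in A1. rewrite Cmod_Ci in A2.
      specialize (A1 eq_refl). specialize (A2 eq_refl).
      specialize (A1 ltac:(unfold Re; simpl; ring) (HM _ Hs1)).
      specialize (A2 ltac:(unfold Re; simpl; ring) (HM _ Hs2)).
      fold (Q (t, -a)) in A1. fold (Q (t, a)) in A2. fold B in A1, A2.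
      unfold p.
      replace (Re (- Ci * Q (t, -a))) with (Im (Q (t, -a))) in A1 by (unfold Re, Im; simpl; ring).
      replace (Re (Ci * Q (t, a))) with (- Im (Q (t, a))) in A2 by (unfold Re, Im; simpl; ring).
      lra.
    - apply (ex_RInt_minus (fun y => q a y) (fun y => q (-a) y)); apply Ey; lra.
    - intros t Ht.
      assert (Hs1 : Csup (-a, t) = a) by (apply Csup_side; try lra; left; rewrite Rabs_Ropp; apply Rabs_right; lra).
      assert (Hs2 : Csup (a, t) = a) by (apply Csup_side; try lra; left; apply Rabs_right; lra).
      assert (A1 := side_integrand_le (g (-a, t)) (- RtoC 1)%C (-a, t) k a M Ha Hk Hs1).
      assert (A2 := side_integrand_le (g (a, t)) (RtoC 1) (a, t) k a M Ha Hk Hs2).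
      rewrite Cmod_opp, Cmod_1 in A1. rewrite Cmod_1 in A2.
      specialize (A1 eq_refl). specialize (A2 eq_refl).
      specialize (A1 ltac:(unfold Re; simpl; ring) (HM _ Hs1)).
      specialize (A2 ltac:(unfold Re; simpl; ring) (HM _ Hs2)).
      fold (Q (-a, t)) in A1. fold (Q (a, t)) in A2. fold B in A1, A2.
      unfold q.
      replace (Re (- RtoC 1 * Q (-a, t))) with (- Re (Q (-a, t))) in A1 by (unfold Re; simpl; ring).
      replace (Re (RtoC 1 * Q (a, t))) with (Re (Q (a, t))) in A2 by (unfold Re; simpl; ring).
      lra. }
  (* Near [0] the numerator of [Q] is at most [eta], so [Cmod (Q z) <= eta / e] on the square of
     half-side [e], whose perimeter is [8 * e]. *)
  assert (Hlow : forall eta, 0 < eta -> - (8 * eta) <= boundary_integral p q (-a) a (-a) a).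
  { intros eta Heta. destruct (Hc eta Heta) as [d [Hd0 Hd1]].
    set (e := Rmin a (d / 4)).
    assert (He : 0 < e <= a) by (split; [apply Rmin_pos; lra | apply Rmin_l]).
    assert (Hed : e <= d / 4) by apply Rmin_r.
    rewrite (boundary_integral_square_shrink p q a e He (fun x y => Hxy e x y He)).
    assert (HQ : forall z, Csup z = e -> Cmod (Q z) <= eta / e).
    { intros z Hz. assert (A := Csup_le_Cmod z). assert (A2 := Cmod_le_Csup z). rewrite Hz in A, A2.
      assert (z <> RtoC 0) by (apply Cmod_gt_0; lra).
      unfold Q. rewrite Cmod_div by auto. rewrite <- Hg0.
      unfold Rdiv. apply Rmult_le_compat; try apply Cmod_ge_0.
      - left; apply Rinv_0_lt_compat; lra.
      - apply Hd1. lra.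
      - apply Rinv_le_contravar; lra. }
    assert (Hee : Rabs (-e) = e /\ Rabs e = e) by (rewrite Rabs_Ropp; split; apply Rabs_right; lra).
    assert (HIm : forall z, Rabs (Im z) <= Cmod z).
    { intros z. eapply Rle_trans; [apply Rmax_r | apply Rmax_Cmod]. }
    unfold boundary_integral.
    assert (B1 := abs_RInt_le_const (fun x => p x (-e) - p x e) (-e) e (2 * (eta / e)) ltac:(lra)
      (ex_RInt_minus (fun x => p x (-e)) (fun x => p x e) _ _
        (Ex e (-e) He (or_introl eq_refl)) (Ex e e He (or_intror eq_refl)))).
    assert (B2 := abs_RInt_le_const (fun y => q e y - q (-e) y) (-e) e (2 * (eta / e)) ltac:(lra)
      (ex_RInt_minus (fun y => q e y) (fun y => q (-e) y) _ _
        (Ey e e He (or_intror eq_refl)) (Ey e (-e) He (or_introl eq_refl)))).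
    assert (E : (e - - e) * (2 * (eta / e)) = 4 * eta) by (field; lra).
    rewrite E in B1, B2.
    assert (Rabs (RInt (fun x => p x (-e) - p x e) (-e) e) <= 4 * eta).
    { apply B1. intros t Ht.
      assert (C1 := HIm (Q (t, -e))). assert (C2 := HIm (Q (t, e))).
      assert (D1 := HQ (t, -e) ltac:(apply Csup_side; tauto || lra)).
      assert (D2 := HQ (t, e) ltac:(apply Csup_side; tauto || lra)).
      unfold p. apply Rabs_le_between in C1, C2. apply Rabs_le. lra. }
    assert (Rabs (RInt (fun y => q e y - q (-e) y) (-e) e) <= 4 * eta).
    { apply B2. intros t Ht.
      assert (C1 := re_le_Cmod (Q (-e, t))). assert (C2 := re_le_Cmod (Q (e, t))).
      assert (D1 := HQ (-e, t) ltac:(apply Csup_side; tauto || lra)).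
      assert (D2 := HQ (e, t) ltac:(apply Csup_side; tauto || lra)).
      unfold q. apply Rabs_le_between in C1, C2. apply Rabs_le. lra. }
    apply Rabs_le_between in H, H0. lra. }
  destruct (Rle_dec k (2 * M)) as [|Hn]; [assumption|exfalso].
  assert (X := Hlow ((k - 2 * M) / 4) ltac:(lra)). lra.
Qed.

(** Multiplying [g] by the conjugate of its value at [0] makes that value real and nonnegative; the
    extra factor cancels afterwards. Asking only for continuity at [0] allows quotients with a
    removable singularity. *)
Lemma center_le_boundary (g : C -> C) (a M : R) : 0 < a ->
  (forall z, Csup z <= a -> z <> RtoC 0 -> exists l, Cderiv g z l) ->
  (forall eps, 0 < eps -> exists delta, 0 < delta /\
     forall z, Cmod z < delta -> Cmod (g z - g (RtoC 0)) <= eps) ->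
  (forall z, Csup z = a -> Cmod (g z) <= M) ->
  Cmod (g (RtoC 0)) <= 2 * M.
Proof.
  intros Ha Hd Hc HM.
  destruct (Ceq_dec (g (RtoC 0)) (RtoC 0)) as [E|E].
  { rewrite E, Cmod_0. assert (H := HM (a, 0) ltac:(apply Csup_side; try lra; left; apply Rabs_right; lra)).
    assert (H' := Cmod_ge_0 (g (a, 0))). lra. }
  set (c := Cconj (g (RtoC 0))).
  assert (Hcm : Cmod c = Cmod (g (RtoC 0))) by apply Cmod_conj.
  assert (Hpos : 0 < Cmod (g (RtoC 0))) by (apply Cmod_gt_0; exact E).
  assert (H : Cmod (g (RtoC 0)) ^ 2 <= 2 * (Cmod c * M)).
  { apply (center_le_boundary_real (fun z => c * g z)%C a); auto.
    - apply pow2_ge_0.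
    - rewrite Cmod2_conj. unfold c. ring.
    - intros z Hz Hz0. destruct (Hd z Hz Hz0) as [l Hl]. eexists.
      apply Cderiv_mult; [apply Cderiv_const | exact Hl].
    - intros eps He. destruct (Hc (eps / Cmod c)) as [d [Hd0 Hd1]].
      { rewrite Hcm. apply Rdiv_lt_0_compat; lra. }
      exists d. split; [exact Hd0|]. intros z Hz. specialize (Hd1 z Hz).
      replace (c * g z - c * g (RtoC 0))%C with (c * (g z - g (RtoC 0)))%C by ring.
      rewrite Cmod_mult. apply Rle_trans with (Cmod c * (eps / Cmod c)).
      + apply Rmult_le_compat_l; lra.
      + right. field. lra.
    - intros z Hz. rewrite Cmod_mult. apply Rmult_le_compat_l; [lra|]. auto. }
  rewrite Hcm in H. nra.
Qed.

Lemma derivative_le_boundary (g : C -> C) (a M : R) (l : C) : 0 < a ->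
  g (RtoC 0) = RtoC 0 -> Cderiv g (RtoC 0) l ->
  (forall z, Csup z <= a -> exists l, Cderiv g z l) ->
  (forall z, Csup z = a -> Cmod (g z) <= M) ->
  Cmod l <= 2 * (M / a).
Proof.
  intros Ha Hg0 Hl Hd HM.
  set (Q := fun z => if Ceq_dec z (RtoC 0) then l else (g z / z)%C).
  assert (Q0 : Q (RtoC 0) = l) by (unfold Q; destruct Ceq_dec; congruence).
  rewrite <- Q0.
  apply (center_le_boundary Q a); auto.
  - intros z Hz Hz0. destruct (Hd z Hz) as [m Hm]. eexists.
    apply (Cderiv_ext_loc (fun z => g z / z)%C _ z _ (Cmod z)).
    + now apply Cmod_gt_0.
    + intros y Hy. unfold Q. destruct Ceq_dec as [E|]; [|reflexivity].
      subst y. replace (RtoC 0 - z)%C with (- z)%C in Hy by ring. rewrite Cmod_opp in Hy. lra.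
    + apply Cderiv_mult; [exact Hm | now apply Cderiv_inv_id].
  - intros eps He. destruct (proj1 (Cderiv_iff g (RtoC 0) l) Hl eps He) as [d [Hd0 Hd1]].
    exists d. split; [exact Hd0|]. intros z Hz. rewrite Q0. unfold Q. destruct Ceq_dec as [E|E].
    + replace (l - l)%C with (RtoC 0) by ring. rewrite Cmod_0; lra.
    + specialize (Hd1 z). replace (z - RtoC 0)%C with z in Hd1 by ring. specialize (Hd1 Hz).
      rewrite Hg0 in Hd1. replace (g z - RtoC 0 - l * z)%C with (g z - l * z)%C in Hd1 by ring.
      replace (g z / z - l)%C with ((g z - l * z) / z)%C by (field; auto).
      rewrite Cmod_div by auto. assert (0 < Cmod z) by now apply Cmod_gt_0.
      apply (Rmult_le_reg_r (Cmod z)); [lra|]. unfold Rdiv. rewrite Rmult_assoc, Rinv_l by lra. lra.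
  - intros z Hz. assert (A := Csup_le_Cmod z). rewrite Hz in A.
    assert (z <> RtoC 0) by (apply Cmod_gt_0; lra).
    unfold Q. destruct Ceq_dec; [contradiction|]. rewrite Cmod_div by auto.
    unfold Rdiv. apply Rmult_le_compat; auto using Cmod_ge_0.
    + left; apply Rinv_0_lt_compat; lra.
    + apply Rinv_le_contravar; lra.
Qed.

(* Cauchy's estimate on a square of half-side [Cmod z] centred at [z], applied to
   [xi |-> f (z + xi) - f z - df 0 * xi], which is [o(Cmod z)] there. *)
Lemma derivative_continuous_at_0 (f df : C -> C) (R0 : R) : 0 < R0 ->
  (forall z, Cmod z < R0 -> Cderiv f z (df z)) ->
  forall eps, 0 < eps -> exists delta, 0 < delta /\
    forall z, Cmod z < delta -> Cmod (df z - df (RtoC 0)) <= eps.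
Proof.
  intros HR Hd eps He.
  assert (H0 : Cderiv f (RtoC 0) (df (RtoC 0))) by (apply Hd; rewrite Cmod_0; exact HR).
  (* On the boundary [Cmod (z + xi) <= 3 * a], so the two linear errors in [g] total
     [eps / 8 * (3 * a + a)], that is [eps / 2 * a]; the Cauchy estimate multiplies by [2 / a]. The
     same [3] fixes the radii below. *)
  destruct (proj1 (Cderiv_iff _ _ _) H0 (eps / 8)) as [d [Hd0 Hd1]]; [lra|].
  assert (Hlin : forall z, Cmod z < d ->
    Cmod (f z - f (RtoC 0) - df (RtoC 0) * z) <= eps / 8 * Cmod z).
  { intros z Hz. specialize (Hd1 z). replace (z - RtoC 0)%C with z in Hd1 by ring. auto. }
  exists (Rmin (R0 / 3) (d / 3)). split; [apply Rmin_pos; lra|].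
  intros z Hz.
  assert (Hz1 := Rlt_le_trans _ _ _ Hz (Rmin_l _ _)).
  assert (Hz2 := Rlt_le_trans _ _ _ Hz (Rmin_r _ _)).
  destruct (Ceq_dec z (RtoC 0)) as [->|Hne].
  { replace (_ - _)%C with (RtoC 0) by ring. rewrite Cmod_0. lra. }
  apply Cmod_gt_0 in Hne. set (a := Cmod z) in *.
  set (g := fun xi => (f (z + xi) - (f z + df (RtoC 0) * xi))%C).
  assert (Hg : forall xi, Csup xi <= a -> Cderiv g xi (df (z + xi) - df (RtoC 0))%C).
  { intros xi Hxi.
    apply Cderiv_minus.
    - apply Cderiv_shift. apply Hd.
      eapply Rle_lt_trans; [apply Cmod_triangle|]. assert (A := Cmod_le_Csup xi). fold a. lra.
    - eapply Cderiv_eq.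
      + apply Cderiv_plus; [apply Cderiv_const|].
        apply Cderiv_mult; [apply Cderiv_const | apply Cderiv_id].
      + cbv beta. ring. }
  assert (Hs0 : Csup (RtoC 0) = 0) by (unfold Csup; simpl; rewrite Rabs_R0; apply Rmax_left; lra).
  assert (X : Cmod (df z - df (RtoC 0)) <= 2 * (eps / 2 * a / a)).
  { apply (derivative_le_boundary g); auto.
    - unfold g. replace (z + RtoC 0)%C with z by ring. ring.
    - eapply Cderiv_eq; [apply Hg; lra|]. now replace (z + RtoC 0)%C with z by ring.
    - intros xi Hxi. eexists. now apply Hg.
    - intros xi Hxi. unfold g.
      assert (A := Cmod_le_Csup xi). rewrite Hxi in A.
      assert (T := Cmod_triangle z xi). fold a in T.
      replace (f (z + xi) - (f z + df (RtoC 0) * xi))%C with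
        ((f (z + xi) - f (RtoC 0) - df (RtoC 0) * (z + xi))
          + - (f z - f (RtoC 0) - df (RtoC 0) * z))%C by ring.
      eapply Rle_trans; [apply Cmod_triangle|]. rewrite Cmod_opp.
      assert (B1 := Hlin (z + xi)%C ltac:(lra)). assert (B2 := Hlin z ltac:(fold a; lra)).
      fold a in B2.
      assert (eps / 8 * Cmod (z + xi) <= eps / 8 * (3 * a)) by (apply Rmult_le_compat_l; lra).
      lra. }
  replace (2 * (eps / 2 * a / a)) with eps in X by (field; lra). exact X.
Qed.

(** * Identity theorem *)

(* Multiplying [F] by [(z0 - c) / (z - c)] keeps its value at [z0] and halves its
   bound on the boundary of the square. *)
Lemma vanishing_decay (z0 c : C) (a : R) : 0 < a -> z0 <> c -> 3 * Cmod (z0 - c) <= a ->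
  forall (m : nat) (F : C -> C) (M : R),
  (forall xi, Csup xi <= a -> exists l, Cderiv F (z0 + xi) l) ->
  (exists e, 0 < e /\ forall z, Cmod (z - c) < e -> F z = RtoC 0) ->
  (forall xi, Csup xi = a -> Cmod (F (z0 + xi)%C) <= M) ->
  Cmod (F z0) <= 2 * M / 2 ^ m.
Proof.
  intros Ha Hne Hac. induction m as [|m IH]; intros F M Hd Hv HM.
  - replace (2 * M / 2 ^ 0) with (2 * M) by (simpl; field).
    replace z0 with (z0 + RtoC 0)%C by ring.
    apply (center_le_boundary (fun xi => F (z0 + xi)%C) a); auto.
    + intros xi Hxi _. destruct (Hd xi Hxi) as [l Hl]. exists l. now apply Cderiv_shift.
    + intros eps He. destruct (Hd (RtoC 0)) as [l Hl].
      { unfold Csup; simpl. rewrite Rabs_R0, Rmax_left; lra. }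
      destruct (Cderiv_continuous _ _ _ Hl eps He) as [d [Hd0 Hd1]].
      exists d. split; [exact Hd0|]. intros z Hz. apply Hd1.
      replace (_ - _)%C with z by ring. exact Hz.
  - set (k := (z0 - c)%C) in *.
    assert (Hk : k <> RtoC 0) by (intros E; apply Hne; replace z0 with (k + c)%C by (unfold k; ring); rewrite E; ring).
    assert (E : F z0 = (fun z => F z * (k / (z - c)))%C z0).
    { cbv beta. fold k. field. exact Hk. }
    rewrite E.
    replace (2 * M / 2 ^ S m) with (2 * (M / 2) / 2 ^ m)
      by (simpl; field; apply pow_nonzero; lra).
    destruct Hv as [e [He Hv]].
    apply (IH (fun z => F z * (k / (z - c)))%C (M / 2)).
    + intros xi Hxi. destruct (Ceq_dec (z0 + xi) c) as [Ec|Ec].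
      (* At [c] the quotient is meaningless, but the product is locally zero because [F] vanishes
         near [c]. *)
      * exists (RtoC 0). rewrite Ec.
        apply (Cderiv_ext_loc (fun _ => RtoC 0) _ c _ e He); [|apply Cderiv_const].
        intros y Hy. rewrite (Hv y Hy). ring.
      * destruct (Hd xi Hxi) as [l Hl]. eexists. apply Cderiv_mult; [exact Hl|].
        apply Cderiv_mult; [apply Cderiv_const|].
        apply (Cderiv_inv (fun z => z - c)%C).
        { intros E'. apply Ec. replace (z0 + xi)%C with ((z0 + xi - c) + c)%C by ring. rewrite E'. ring. }
        apply Cderiv_minus; [apply Cderiv_id | apply Cderiv_const].
    + exists e. split; [exact He|]. intros z Hz. rewrite (Hv z Hz). ring.
    + intros xi Hxi.
      assert (A := Csup_le_Cmod xi). rewrite Hxi in A.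
      assert (T := Cmod_triangle (z0 + xi - c) (- k)).
      replace (z0 + xi - c + - k)%C with xi in T by (unfold k; ring). rewrite Cmod_opp in T.
      assert (Hk' := proj1 (Cmod_gt_0 k) Hk).
      (* From [Cmod xi >= a >= 3 * Cmod k]; this makes the factor at most [1 / 2] on the
         boundary. *)
      assert (Hzc : 2 * Cmod k <= Cmod (z0 + xi - c)) by lra.
      assert (z0 + xi - c <> RtoC 0)%C by (apply Cmod_gt_0; lra).
      rewrite Cmod_mult, Cmod_div by auto. specialize (HM xi Hxi).
      unfold Rdiv at 2. apply Rmult_le_compat; auto using Cmod_ge_0.
      * apply Rmult_le_pos; [lra|]. left; apply Rinv_0_lt_compat; lra.
      * apply (Rmult_le_reg_r (Cmod (z0 + xi - c))); [lra|].
        unfold Rdiv. rewrite Rmult_assoc, Rinv_l by lra. lra.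
Qed.

Lemma segment_bounded (F : C -> C) (z v : C) (a : R) : 0 < a -> Cmod v = 1 ->
  (forall t, -a <= t <= a -> exists l, Cderiv F (z + RtoC t * v) l) ->
  exists M, forall t, -a <= t <= a -> Cmod (F (z + RtoC t * v)%C) <= M.
Proof.
  intros Ha Hv Hd.
  destruct (continuity_ab_maj (fun t => Cmod (F (z + RtoC t * v)%C)) (-a) a) as [m [Hm _]].
  - lra.
  - intros t Ht. destruct (Hd t Ht) as [l Hl]. intros eps He.
    destruct (Cderiv_continuous _ _ _ Hl (eps / 2)) as [d [Hd0 Hd1]]; [lra|].
    exists d. split; [lra|]. intros s [_ Hs]. simpl in *. unfold R_dist in *.
    assert (X : Cmod (F (z + RtoC s * v) - F (z + RtoC t * v))%C <= eps / 2).
    { apply Hd1. replace (z + RtoC s * v - (z + RtoC t * v))%C with (RtoC (s - t) * v)%C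
        by (rewrite RtoC_minus; ring).
      rewrite Cmod_mult, Hv, Cmod_R. lra. }
    set (A := F (z + RtoC s * v)%C) in *. set (B := F (z + RtoC t * v)%C) in *.
    assert (T1 := Cmod_triangle (A - B) B). assert (T2 := Cmod_triangle (- (A - B)) A).
    rewrite Cmod_opp in T2.
    replace (A - B + B)%C with A in T1 by ring. replace (- (A - B) + A)%C with B in T2 by ring.
    apply Rle_lt_trans with (eps / 2); [|lra]. apply Rabs_le. lra.
  - exists (Cmod (F (z + RtoC m * v)%C)). exact Hm.
Qed.

(** Supplies the initial bound that [vanishing_decay] halves. Compactness is used in one real
    variable, side by side. *)
Lemma square_boundary_bounded (F : C -> C) (z : C) (a : R) : 0 < a ->
  (forall xi, Csup xi <= a -> exists l, Cderiv F (z + xi) l) ->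
  exists M, forall xi, Csup xi = a -> Cmod (F (z + xi)%C) <= M.
Proof.
  intros Ha Hd.
  assert (Hseg : forall u v, Cmod v = 1 ->
    (forall t, -a <= t <= a -> Csup (u + RtoC t * v) <= a) ->
    exists M, forall t, -a <= t <= a -> Cmod (F (z + u + RtoC t * v)%C) <= M).
  { intros u v Hv Hu. apply segment_bounded; auto.
    intros t Ht. destruct (Hd _ (Hu t Ht)) as [l Hl]. exists l.
    now rewrite <- Cplus_assoc. }
  destruct (Hseg (a, 0) Ci Cmod_Ci) as [M1 H1].
  { intros t Ht. replace ((a, 0) + RtoC t * Ci)%C with (a, t)
      by (apply injective_projections; simpl; ring). apply Csup_pair; lra. }
  destruct (Hseg ((-a)%R, 0) Ci Cmod_Ci) as [M2 H2].
  { intros t Ht. replace (((-a)%R, 0) + RtoC t * Ci)%C with ((-a)%R, t)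
      by (apply injective_projections; simpl; ring). apply Csup_pair; lra. }
  destruct (Hseg (0, a) (RtoC 1) Cmod_1) as [M3 H3].
  { intros t Ht. replace ((0, a) + RtoC t * RtoC 1)%C with (t, a)
      by (apply injective_projections; simpl; ring). apply Csup_pair; lra. }
  destruct (Hseg (0, (-a)%R) (RtoC 1) Cmod_1) as [M4 H4].
  { intros t Ht. replace ((0, (-a)%R) + RtoC t * RtoC 1)%C with (t, (-a)%R)
      by (apply injective_projections; simpl; ring). apply Csup_pair; lra. }
  exists (Rmax (Rmax M1 M2) (Rmax M3 M4)).
  assert (A1 := Rmax_l M1 M2). assert (A2 := Rmax_r M1 M2).
  assert (A3 := Rmax_l M3 M4). assert (A4 := Rmax_r M3 M4).
  assert (A5 := Rmax_l (Rmax M1 M2) (Rmax M3 M4)). assert (A6 := Rmax_r (Rmax M1 M2) (Rmax M3 M4)).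
  intros [x y] Hxy. unfold Csup in Hxy; simpl in Hxy.
  assert (Hx : Rabs x <= a) by (rewrite <- Hxy; apply Rmax_l).
  assert (Hy : Rabs y <= a) by (rewrite <- Hxy; apply Rmax_r).
  assert (Hor : Rabs x = a \/ Rabs y = a).
  { unfold Rmax in Hxy. destruct Rle_dec; auto. }
  apply Rabs_le_between in Hx, Hy.
  assert (Hor4 : x = a \/ x = -a \/ y = a \/ y = -a).
  { unfold Rabs in Hor. do 2 destruct Rcase_abs; destruct Hor; lra. }
  destruct Hor4 as [->|[->|[->| ->]]].
  - specialize (H1 y Hy). replace (z + (a, y))%C with (z + (a, 0) + RtoC y * Ci)%C
      by (apply injective_projections; simpl; ring). lra.
  - specialize (H2 y Hy). replace (z + ((-a)%R, y))%C with (z + ((-a)%R, 0) + RtoC y * Ci)%C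
      by (apply injective_projections; simpl; ring). lra.
  - specialize (H3 x Hx). replace (z + (x, a))%C with (z + (0, a) + RtoC x * RtoC 1)%C
      by (apply injective_projections; simpl; ring). lra.
  - specialize (H4 x Hx). replace (z + (x, (-a)%R))%C with (z + (0, (-a)%R) + RtoC x * RtoC 1)%C
      by (apply injective_projections; simpl; ring). lra.
Qed.

Lemma vanishing_spread (F : C -> C) (z0 c : C) (a : R) : 0 < a -> 3 * Cmod (z0 - c) <= a ->
  (forall xi, Csup xi <= a -> exists l, Cderiv F (z0 + xi) l) ->
  (exists e, 0 < e /\ forall z, Cmod (z - c) < e -> F z = RtoC 0) ->
  F z0 = RtoC 0.
Proof.
  intros Ha Hac Hd Hv.
  destruct (Ceq_dec z0 c) as [->|Hne].
  { destruct Hv as [e [He Hv]]. apply Hv. replace (c - c)%C with (RtoC 0) by ring.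
    rewrite Cmod_0. exact He. }
  destruct (square_boundary_bounded F z0 a Ha Hd) as [M HM].
  assert (H := fun m => vanishing_decay z0 c a Ha Hne Hac m F M Hd Hv HM).
  apply Cmod_eq_0. destruct (Req_dec (Cmod (F z0)) 0) as [|Hn]; [assumption|exfalso].
  assert (Hp : 0 < Cmod (F z0)) by (assert (X := Cmod_ge_0 (F z0)); lra).
  (* The case without any factor shows [M > 0], so that division by [2 * M] is legitimate. *)
  assert (H0 := H 0%nat). simpl in H0.
  assert (HMp : 0 < M) by lra.
  destruct (pow_lt_1_zero (/ 2)) with (y := Cmod (F z0) / (2 * M)) as [N HN].
  { rewrite Rabs_right; lra. }
  { apply Rdiv_lt_0_compat; lra. }
  specialize (HN N (Nat.le_refl N)). specialize (H N).
  assert (H2N : 0 < 2 ^ N) by (apply pow_lt; lra).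
  rewrite pow_inv, Rabs_right in HN by (left; apply Rinv_0_lt_compat; lra).
  assert (/ 2 ^ N * (2 * M) < Cmod (F z0)).
  { apply (Rmult_lt_reg_r (/ (2 * M))); [apply Rinv_0_lt_compat; lra|].
    rewrite Rmult_assoc, Rinv_r by lra. rewrite Rmult_1_r. exact HN. }
  unfold Rdiv in H. lra.
Qed.

(** Concentric discs replace a connectedness argument: each step enlarges the zero disc by a
    sixteenth of the gap to [R0], so the gap decreases geometrically to [0]. *)
Lemma identity_theorem_disc (F : C -> C) (R0 e : R) : 0 < e ->
  (forall z, Cmod z < R0 -> exists l, Cderiv F z l) ->
  (forall z, Cmod z < e -> F z = RtoC 0) ->
  forall z, Cmod z < R0 -> F z = RtoC 0.
Proof.
  intros He Hd Hv z Hz.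
  destruct (Rlt_dec (Cmod z) e) as [|Hze]; [auto|].
  assert (HeR : e < R0) by lra.
  assert (Hstep : forall t, 0 < t < R0 -> (forall y, Cmod y < t -> F y = RtoC 0) ->
    forall y, Cmod y < t + (R0 - t) / 16 -> F y = RtoC 0).
  { intros t Ht Hvt y Hy. set (s := R0 - t) in *.
    assert (Hs : 0 < s) by (unfold s; lra).
    (* The point [c] is [y] moved towards [0] by [s / 8], or [0] itself when [y] is that close. As
       [y] exceeds radius [t] by less than [s / 16], [c] is inside the zero disc. *)
    assert (Hc : exists c, Cmod c < t /\ Cmod (y - c) <= s / 8).
    { destruct (Rle_dec (Cmod y) (s / 8)) as [Hys|Hys].
      - exists (RtoC 0). rewrite Cmod_0. replace (y - RtoC 0)%C with y by ring. lra.
      - assert (Hy0 : 0 < Cmod y) by lra.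
        set (eta := s / 8 / Cmod y).
        assert (Heta : eta * Cmod y = s / 8) by (unfold eta; field; lra).
        assert (0 < eta) by (apply Rdiv_lt_0_compat; lra).
        assert (eta < 1) by (apply (Rmult_lt_reg_r (Cmod y)); lra).
        exists (RtoC (1 - eta) * y)%C.
        replace (y - RtoC (1 - eta) * y)%C with (RtoC eta * y)%C by (rewrite RtoC_minus; ring).
        rewrite !Cmod_mult, !Cmod_R, !Rabs_right by lra. lra. }
    destruct Hc as [c [Hc1 Hc2]].
    (* The half-side is three times [s / 8]. Points of the square have modulus below
       [t + s / 16 + 3 * s / 4], which is less than [R0]. *)
    apply (vanishing_spread F y c (3 * s / 8)); [lra|lra| |].
    - intros xi Hxi. apply Hd. eapply Rle_lt_trans; [apply Cmod_triangle|].
      assert (A := Cmod_le_Csup xi). unfold s in *. lra.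
    - exists (t - Cmod c). split; [lra|]. intros x Hx. apply Hvt.
      assert (T := Cmod_triangle (x - c) c). replace (x - c + c)%C with x in T by ring. lra. }
  set (rad := fun n => R0 - (15 / 16) ^ n * (R0 - e)).
  assert (Hrad : forall n, e <= rad n < R0).
  { intros n. unfold rad. assert (0 < (15 / 16) ^ n) by (apply pow_lt; lra).
    assert ((15 / 16) ^ n <= 1).
    { rewrite <- (pow1 n). apply pow_incr; lra. }
    nra. }
  assert (Hall : forall n y, Cmod y < rad n -> F y = RtoC 0).
  { induction n as [|n IH]; intros y Hy.
    - apply Hv. unfold rad in Hy; simpl in Hy. lra.
    - assert (A := Hrad n).
      apply (Hstep (rad n)); [lra|exact IH|].
      replace (rad n + (R0 - rad n) / 16) with (rad (S n)) by (unfold rad; simpl; field).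
      exact Hy. }
  destruct (pow_lt_1_zero (15 / 16)) with (y := (R0 - Cmod z) / (R0 - e)) as [N HN].
  { rewrite Rabs_right; lra. }
  { apply Rdiv_lt_0_compat; lra. }
  specialize (HN N (Nat.le_refl N)).
  assert (HP : 0 < (15 / 16) ^ N) by (apply pow_lt; lra).
  rewrite Rabs_right in HN by lra.
  apply (Hall N). unfold rad.
  assert ((15 / 16) ^ N * (R0 - e) < R0 - Cmod z).
  { apply (Rmult_lt_reg_r (/ (R0 - e))); [apply Rinv_0_lt_compat; lra|].
    rewrite Rmult_assoc, Rinv_r by lra. rewrite Rmult_1_r. exact HN. }
  lra.
Qed.

(** * A singular Gronwall inequality *)

Lemma Cderiv_ray_Re (f : C -> C) (z l : C) (t : R) :
  Cderiv f (RtoC t * z) l -> is_derive (fun s => Re (f (RtoC s * z)%C)) t (Re (z * l)).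
Proof.
  intros H. apply is_derive_Reals. intros eps He.
  assert (Hz := Cmod_ge_0 z).
  destruct (proj1 (Cderiv_iff _ _ _) H (eps / (1 + 2 * Cmod z))) as [d [Hd H']].
  { apply Rdiv_lt_0_compat; lra. }
  assert (Hd' : 0 < d / (1 + Cmod z)) by (apply Rdiv_lt_0_compat; lra).
  exists (mkposreal _ Hd'). intros h Hh Hhd. simpl in Hhd.
  assert (Hh0 : 0 < Rabs h) by now apply Rabs_pos_lt.
  specialize (H' (RtoC (t + h) * z)%C).
  replace (RtoC (t + h) * z - RtoC t * z)%C with (RtoC h * z)%C in H' by (rewrite RtoC_plus; ring).
  rewrite Cmod_mult, Cmod_R in H'.
  assert (Hlt : Rabs h * (1 + Cmod z) < d).
  { apply (Rmult_lt_reg_r (/ (1 + Cmod z))); [apply Rinv_0_lt_compat; lra|].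
    rewrite Rmult_assoc, Rinv_r by lra. rewrite Rmult_1_r. exact Hhd. }
  specialize (H' ltac:(nra)).
  set (V := (f (RtoC (t + h) * z) - f (RtoC t * z) - l * (RtoC h * z))%C) in H'.
  replace (_ - _) with (Re V / h) by (unfold V, Re; simpl; field; exact Hh).
  unfold Rdiv. rewrite Rabs_mult, Rabs_inv.
  apply (Rmult_lt_reg_r (Rabs h)); [lra|]. rewrite Rmult_assoc, Rinv_l, Rmult_1_r by lra.
  eapply Rle_lt_trans; [apply re_le_Cmod|]. eapply Rle_lt_trans; [exact H'|].
  replace (eps / (1 + 2 * Cmod z) * (Rabs h * Cmod z))
    with (eps * Rabs h * (Cmod z / (1 + 2 * Cmod z))) by (field; lra).
  assert (Cmod z / (1 + 2 * Cmod z) < 1).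
  { apply (Rmult_lt_reg_r (1 + 2 * Cmod z)); [lra|]. unfold Rdiv.
    rewrite Rmult_assoc, Rinv_l by lra. lra. }
  assert (0 < eps * Rabs h) by nra. nra.
Qed.

Lemma Cderiv_ray_Im (f : C -> C) (z l : C) (t : R) :
  Cderiv f (RtoC t * z) l -> is_derive (fun s => Im (f (RtoC s * z)%C)) t (Im (z * l)).
Proof.
  intros H.
  assert (H1 : Cderiv (fun y => (- Ci) * f y)%C (RtoC t * z) ((- Ci) * l)%C).
  { eapply Cderiv_eq; [apply Cderiv_mult; [apply Cderiv_const | exact H] | cbv beta; ring]. }
  apply Cderiv_ray_Re in H1.
  replace (Im (z * l)) with (Re (z * (- Ci * l))) by (unfold Re, Im; simpl; ring).
  eapply is_derive_ext; [|exact H1]. intros s. unfold Re, Im; simpl; ring.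
Qed.

(* Along a ray, [Cmod (D (t z)) ^ 2 / t ^ 3] is nonincreasing and tends to [0] at [0]. *)
Lemma singular_gronwall (D dD : C -> C) (r M : R) :
  (forall z, 0 < Cmod z < r -> Cderiv D z (dD z)) ->
  (forall z, 0 < Cmod z < r -> 2 * (Cmod z * Cmod (dD z)) <= 3 * Cmod (D z)) ->
  (forall z, 0 < Cmod z < r -> Cmod (D z) <= M * Cmod z ^ 2) ->
  forall z, 0 < Cmod z < r -> D z = RtoC 0.
Proof.
  intros Hd Hg HM z Hz.
  set (x := fun t => Re (D (RtoC t * z)%C)). set (y := fun t => Im (D (RtoC t * z)%C)).
  set (dx := fun t => Re (z * dD (RtoC t * z))%C). set (dy := fun t => Im (z * dD (RtoC t * z))%C).
  set (phi := fun t => (x t ^ 2 + y t ^ 2) / t ^ 3).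
  set (dphi := fun t => (t * (2 * (x t * dx t + y t * dy t)) - 3 * (x t ^ 2 + y t ^ 2)) / t ^ 4).
  assert (Ht : forall t, 0 < t <= 1 -> Cmod (RtoC t * z) = t * Cmod z /\ 0 < Cmod (RtoC t * z) < r).
  { intros t Ht. rewrite Cmod_mult, Cmod_R, Rabs_right by lra. nra. }
  assert (Hphi : forall t, 0 < t <= 1 -> is_derive phi t (dphi t)).
  { intros t Ht1. destruct (Ht t Ht1) as [_ Ht2].
    assert (X := Cderiv_ray_Re _ _ _ _ (Hd _ Ht2)). assert (Y := Cderiv_ray_Im _ _ _ _ (Hd _ Ht2)).
    fold x in X. fold y in Y. unfold phi.
    replace (dphi t) with
      (((INR 2 * dx t * x t ^ 1 + INR 2 * dy t * y t ^ 1) * t ^ 3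
         - (x t ^ 2 + y t ^ 2) * (INR 3 * 1 * t ^ 2)) / (t ^ 3) ^ 2)
      by (unfold dphi; simpl; field; lra).
    apply (is_derive_div (fun t => x t ^ 2 + y t ^ 2) (fun t => t ^ 3)).
    - apply (is_derive_plus (fun t => x t ^ 2) (fun t => y t ^ 2)).
      + apply (is_derive_pow x 2 t _ X).
      + apply (is_derive_pow y 2 t _ Y).
    - apply (is_derive_pow (fun t => t) 3 t 1). apply (is_derive_id (K := R_AbsRing)).
    - apply pow_nonzero; lra. }
  assert (Hmod : forall t, x t ^ 2 + y t ^ 2 = Cmod (D (RtoC t * z)%C) ^ 2).
  { intros t. now rewrite Cmod2_alt. }
  (* The growth hypothesis and Cauchy-Schwarz bound the derivative of the squared modulus along the
     ray by [3 / t] times itself, exactly what the weight [t ^ 3] compensates. *)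
  assert (Hneg : forall t, 0 < t <= 1 -> dphi t <= 0).
  { intros t Ht1. destruct (Ht t Ht1) as [Ht2 Ht3]. specialize (Hg _ Ht3).
    rewrite Ht2 in Hg. unfold dphi. rewrite Hmod.
    assert (CS : x t * dx t + y t * dy t <= Cmod (D (RtoC t * z)%C) * (Cmod z * Cmod (dD (RtoC t * z)%C))).
    { replace (x t * dx t + y t * dy t) with (Re (Cconj (D (RtoC t * z)) * (z * dD (RtoC t * z)))%C)
        by (unfold x, y, dx, dy, Re, Im; simpl; ring).
      eapply Rle_trans; [apply Re_le_Cmod|]. rewrite !Cmod_mult, Cmod_conj. lra. }
    set (m := Cmod (D (RtoC t * z)%C)) in *. assert (0 <= m) by apply Cmod_ge_0.
    set (n := Cmod z * Cmod (dD (RtoC t * z)%C)) in *.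
    assert (0 < t ^ 4) by (apply pow_lt; lra).
    assert (0 < / t ^ 4) by now apply Rinv_0_lt_compat.
    assert (t * (2 * (x t * dx t + y t * dy t)) <= t * (2 * (m * n))) by (apply Rmult_le_compat_l; lra).
    assert (m * (2 * (t * Cmod z * Cmod (dD (RtoC t * z)%C))) <= m * (3 * m)) by (apply Rmult_le_compat_l; lra).
    unfold Rdiv. assert (t * (2 * (x t * dx t + y t * dy t)) - 3 * m ^ 2 <= 0) by (unfold n in *; nra).
    nra. }
  assert (Hdec : forall s, 0 < s < 1 -> phi 1 <= phi s).
  { intros s Hs.
    destruct (MVT_gen phi s 1 dphi) as [c [Hc E]].
    - rewrite Rmin_left, Rmax_right by lra. intros t Ht1. apply Hphi; lra.
    - rewrite Rmin_left, Rmax_right by lra. intros t Ht1.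
      apply continuity_pt_filterlim, (ex_derive_continuous (K := R_AbsRing) (V := R_NormedModule) phi).
      exists (dphi t). apply Hphi; lra.
    - rewrite Rmin_left, Rmax_right in Hc by lra.
      assert (A := Hneg c ltac:(lra)). nra. }
  assert (HM0 : 0 <= M).
  { assert (A := HM z Hz). assert (B := Cmod_ge_0 (D z)).
    assert (0 < Cmod z ^ 2) by (apply pow_lt; lra). nra. }
  set (K := M ^ 2 * Cmod z ^ 4).
  assert (HK : 0 <= K).
  { unfold K. assert (0 < Cmod z ^ 4) by (apply pow_lt; lra). nra. }
  (* The squared modulus is [O(s^4)], so one power of [s] survives the division by [s ^ 3]. *)
  assert (Hsmall : forall s, 0 < s < 1 -> Cmod (D z) ^ 2 <= K * s).
  { intros s Hs. assert (A := Hdec s Hs). unfold phi in A. rewrite !Hmod in A.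
    replace (RtoC 1 * z)%C with z in A by ring. rewrite pow1, Rdiv_1_r in A.
    destruct (Ht s ltac:(lra)) as [B1 B2]. assert (B3 := HM _ B2). rewrite B1 in B3.
    eapply Rle_trans; [exact A|].
    assert (0 < s ^ 3) by (apply pow_lt; lra).
    apply (Rmult_le_reg_r (s ^ 3)); [lra|]. unfold Rdiv. rewrite Rmult_assoc, Rinv_l, Rmult_1_r by lra.
    replace (K * s * s ^ 3) with ((M * (s * Cmod z) ^ 2) ^ 2) by (unfold K; ring).
    apply pow_incr. split; [apply Cmod_ge_0 | exact B3]. }
  apply Cmod_eq_0. destruct (Req_dec (Cmod (D z)) 0) as [|Hn]; [assumption|exfalso].
  assert (Hp : 0 < Cmod (D z) ^ 2).
  { apply pow_lt. assert (X := Cmod_ge_0 (D z)). lra. }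
  set (e := Cmod (D z) ^ 2) in *.
  (* Chosen so that [K * s < e], with [s < 1] even when [K = 0]. *)
  assert (X := Hsmall (e / (2 * (K + e)))).
  assert (E : e / (2 * (K + e)) * (2 * (K + e)) = e) by (field; lra).
  set (s := e / (2 * (K + e))) in *.
  assert (0 < s) by (apply Rdiv_lt_0_compat; lra).
  assert (s < 1) by nra. specialize (X ltac:(lra)). nra.
Qed.

(** The point [0] is excluded because [w z / z] is among the functions considered. *)
Definition lim0 (f : C -> C) (l : C) : Prop :=
  forall eps, 0 < eps -> exists delta, 0 < delta /\
    forall z, 0 < Cmod z < delta -> Cmod (f z - l) <= eps.

Lemma lim0_const (c : C) : lim0 (fun _ => c) c.
Proof.
  intros eps He. exists 1. split; [lra|]. intros z _.
  replace (c - c)%C with (RtoC 0) by ring. rewrite Cmod_0. lra.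
Qed.

Lemma lim0_continuous (f : C -> C) :
  (forall eps, 0 < eps -> exists delta, 0 < delta /\
     forall z, Cmod z < delta -> Cmod (f z - f (RtoC 0)) <= eps) ->
  lim0 f (f (RtoC 0)).
Proof.
  intros H eps He. destruct (H eps He) as [d [Hd H']]. exists d. split; [exact Hd|].
  intros z Hz. apply H'. lra.
Qed.

Lemma lim0_Cderiv (f : C -> C) (l : C) : Cderiv f (RtoC 0) l -> lim0 f (f (RtoC 0)).
Proof.
  intros H. apply lim0_continuous. intros eps He.
  destruct (Cderiv_continuous _ _ _ H eps He) as [d [Hd H']]. exists d. split; [exact Hd|].
  intros z Hz. apply H'. now replace (z - RtoC 0)%C with z by ring.
Qed.

Lemma lim0_id : lim0 (fun z => z) (RtoC 0).
Proof. exact (lim0_Cderiv (fun z => z) _ (Cderiv_id _)). Qed.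

Lemma lim0_plus (f g : C -> C) (a b : C) :
  lim0 f a -> lim0 g b -> lim0 (fun z => f z + g z)%C (a + b)%C.
Proof.
  intros Hf Hg eps He.
  destruct (Hf (eps / 2)) as [d1 [Hd1 H1]]; [lra|].
  destruct (Hg (eps / 2)) as [d2 [Hd2 H2]]; [lra|].
  exists (Rmin d1 d2). split; [now apply Rmin_pos|]. intros z Hz.
  assert (A1 := Rmin_l d1 d2). assert (A2 := Rmin_r d1 d2).
  replace (f z + g z - (a + b))%C with ((f z - a) + (g z - b))%C by ring.
  eapply Rle_trans; [apply Cmod_triangle|].
  specialize (H1 z ltac:(lra)). specialize (H2 z ltac:(lra)). lra.
Qed.

Lemma lim0_mult (f g : C -> C) (a b : C) :
  lim0 f a -> lim0 g b -> lim0 (fun z => f z * g z)%C (a * b)%C.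
Proof.
  intros Hf Hg eps He.
  assert (Ha := Cmod_ge_0 a). assert (Hb := Cmod_ge_0 b).
  set (e := eps / (1 + Cmod a + Cmod b + eps)).
  assert (He' : 0 < e) by (apply Rdiv_lt_0_compat; lra).
  assert (Ee : e * (1 + Cmod a + Cmod b + eps) = eps) by (unfold e; field; lra).
  destruct (Hf e He') as [d1 [Hd1 H1]]. destruct (Hg e He') as [d2 [Hd2 H2]].
  exists (Rmin d1 d2). split; [now apply Rmin_pos|]. intros z Hz.
  assert (A1 := Rmin_l d1 d2). assert (A2 := Rmin_r d1 d2).
  specialize (H1 z ltac:(lra)). specialize (H2 z ltac:(lra)).
  replace (f z * g z - a * b)%C with ((f z - a) * (g z - b) + (a * (g z - b) + (f z - a) * b))%C by ring.
  eapply Rle_trans; [apply Cmod_triangle|].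
  assert (T := Cmod_triangle (a * (g z - b)) ((f z - a) * b)). rewrite !Cmod_mult in *.
  assert (e <= 1) by nra.
  assert (0 <= Cmod (f z - a)) by apply Cmod_ge_0. assert (0 <= Cmod (g z - b)) by apply Cmod_ge_0.
  assert (Cmod (f z - a) * Cmod (g z - b) <= e * 1) by (apply Rmult_le_compat; lra).
  assert (Cmod a * Cmod (g z - b) <= Cmod a * e) by (apply Rmult_le_compat_l; lra).
  assert (Cmod (f z - a) * Cmod b <= e * Cmod b) by (apply Rmult_le_compat_r; lra).
  nra.
Qed.

Lemma lim0_eq (f : C -> C) (a b : C) : lim0 f a -> a = b -> lim0 f b.
Proof. now intros H <-. Qed.

Lemma lim0_quotient (f : C -> C) (l : C) : f (RtoC 0) = RtoC 0 -> Cderiv f (RtoC 0) l ->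
  lim0 (fun z => f z / z)%C l.
Proof.
  intros H0 H eps He. destruct (proj1 (Cderiv_iff _ _ _) H eps He) as [d [Hd H']].
  exists d. split; [exact Hd|]. intros z Hz. specialize (H' z).
  rewrite H0 in H'. replace (z - RtoC 0)%C with z in H' by ring.
  replace (f z - RtoC 0 - l * z)%C with (f z - l * z)%C in H' by ring. specialize (H' ltac:(lra)).
  assert (z <> RtoC 0) by (apply Cmod_gt_0; lra).
  replace (f z / z - l)%C with ((f z - l * z) / z)%C by (field; auto).
  rewrite Cmod_div by auto. apply (Rmult_le_reg_r (Cmod z)); [lra|].
  unfold Rdiv. rewrite Rmult_assoc, Rinv_l by lra. lra.
Qed.

(** * The quartic differential equation *)

Open Scope C_scope.

Definition quartic (A u : C) : C :=
  RtoC 4 * u * (RtoC 32 * u * u * u - RtoC 48 * u * u + RtoC 18 * u - RtoC 2 * A).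

(** The divided difference of [quartic], written as a polynomial so that it has a limit, [-8 A], as
    [u] and [v] tend to [0]. *)
Definition quartic_slope (A u v : C) : C :=
  RtoC 128 * (u * u * u + (u * u * v + (u * v * v + v * v * v)))
  + ((- RtoC 192) * (u * u + (u * v + v * v)) + (RtoC 72 * (u + v) + (- RtoC 8) * A)).

Lemma quartic_sub (A u v : C) :
  quartic A u - quartic A v = (u - v) * quartic_slope A u v.
Proof. unfold quartic, quartic_slope.
  (* The literals are atoms for [ring], so the numerical relations between them are given
     explicitly, here and below. *)
  replace (RtoC 128) with (RtoC 4 * RtoC 32) by (rewrite <- RtoC_mult; f_equal; ring).
  replace (RtoC 192) with (RtoC 4 * RtoC 48) by (rewrite <- RtoC_mult; f_equal; ring).
  replace (RtoC 72) with (RtoC 4 * RtoC 18) by (rewrite <- RtoC_mult; f_equal; ring).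
  replace (RtoC 8) with (RtoC 4 * RtoC 2) by (rewrite <- RtoC_mult; f_equal; ring).
  ring. Qed.

Lemma T6_expand (x : C) :
  T6 x = RtoC 32 * (x * x) * (x * x) * (x * x) - RtoC 48 * (x * x) * (x * x)
         + RtoC 18 * (x * x) - RtoC 1.
Proof.
  unfold T6, chebT. simpl.
  replace (RtoC 32) with (RtoC 2 * RtoC 2 * RtoC 2 * RtoC 2 * RtoC 2)
    by (rewrite <- !RtoC_mult; f_equal; ring).
  replace (RtoC 48) with (RtoC 2 * RtoC 2 * RtoC 2 * RtoC 2 * (RtoC 2 + RtoC 1))
    by (rewrite <- !RtoC_plus, <- !RtoC_mult; f_equal; ring).
  replace (RtoC 18) with (RtoC 2 * (RtoC 2 * RtoC 2 * RtoC 2 + RtoC 1))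
    by (rewrite <- ?RtoC_mult, <- !RtoC_plus, <- !RtoC_mult; f_equal; ring).
  replace (RtoC 2) with (RtoC 1 + RtoC 1) by (rewrite <- !RtoC_plus; f_equal; ring).
  ring.
Qed.

(** [T6] is even, so after multiplication by [4 w^2] the right-hand side is a polynomial in
    [w^2]. *)
Lemma square_quartic (A w dw : C) :
  dw * dw = T6 w - (RtoC 2 * A - RtoC 1) ->
  (RtoC 2 * w * dw) * (RtoC 2 * w * dw) = quartic A (w * w).
Proof.
  intros H. replace (RtoC 2 * w * dw * (RtoC 2 * w * dw)) with (RtoC 4 * (w * w) * (dw * dw))
    by (replace (RtoC 4) with (RtoC 2 * RtoC 2) by (rewrite <- RtoC_mult; f_equal; ring); ring).
  rewrite H, T6_expand. unfold quartic. ring.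
Qed.

(** In [y = 6 - P] the Weierstrass cubic becomes the one in [H']; inserting [y = 2 A / u] and
    multiplying by [4 A^2 / y^4] yields the quartic, whose root [u = 0] corresponds to the pole of
    [P]. *)
Lemma weierstrass_quartic (A : R) (P dP : C) : RtoC 6 - P <> RtoC 0 ->
  dP * dP = RtoC 4 * P * P * P - RtoC (48 * (1 + 8 * (1 - A))) * P
            - RtoC (64 * (1 - 20 * (1 - A) - 8 * (1 - A) ^ 2)) ->
  (RtoC 2 * RtoC A * dP / ((RtoC 6 - P) * (RtoC 6 - P)))
  * (RtoC 2 * RtoC A * dP / ((RtoC 6 - P) * (RtoC 6 - P)))
  = quartic (RtoC A) (RtoC 2 * RtoC A / (RtoC 6 - P)).
Proof.
  intros Hy H.
  replace (48 * (1 + 8 * (1 - A)))%R with (432 - 384 * A)%R in H by ring.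
  replace (64 * (1 - 20 * (1 - A) - 8 * (1 - A) ^ 2))%R with (2304 * A - 1728 - 512 * (A * A))%R in H by ring.
  set (y := RtoC 6 - P) in *.
  assert (EP : P = RtoC 6 - y) by (unfold y; ring).
  assert (H' : dP * dP = (- RtoC 4) * y * y * y + RtoC 72 * y * y - RtoC 384 * RtoC A * y
    + RtoC 512 * RtoC A * RtoC A).
  { rewrite H, EP.
    rewrite !RtoC_minus, !RtoC_mult.
    replace (RtoC 1728) with (RtoC 8 * RtoC 6 * RtoC 6 * RtoC 6) by (rewrite <- !RtoC_mult; f_equal; ring).
    replace (RtoC 2304) with (RtoC 384 * RtoC 6) by (rewrite <- !RtoC_mult; f_equal; ring).
    replace (RtoC 432) with (RtoC 4 * RtoC 18 * RtoC 6) by (rewrite <- !RtoC_mult; f_equal; ring).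
    replace (RtoC 72) with (RtoC 4 * RtoC 18) by (rewrite <- !RtoC_mult; f_equal; ring).
    replace (RtoC 18) with (RtoC 3 * RtoC 6) by (rewrite <- !RtoC_mult; f_equal; ring).
    replace (RtoC 8) with (RtoC 4 + RtoC 4) by (rewrite <- !RtoC_plus; f_equal; ring).
    replace (RtoC 3) with (RtoC 1 + RtoC 1 + RtoC 1) by (rewrite <- !RtoC_plus; f_equal; ring).
    ring. }
  replace (RtoC 2 * RtoC A * dP / (y * y) * (RtoC 2 * RtoC A * dP / (y * y)))
    with (RtoC 2 * RtoC 2 * RtoC A * RtoC A * (dP * dP) / (y * y * y * y)) by (field; auto).
  rewrite H'. unfold quartic.
  replace (RtoC 512) with (RtoC 2 * RtoC 2 * RtoC 2 * RtoC 2 * RtoC 32) by (rewrite <- !RtoC_mult; f_equal; ring).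
  replace (RtoC 384) with (RtoC 2 * RtoC 2 * RtoC 2 * RtoC 48) by (rewrite <- !RtoC_mult; f_equal; ring).
  replace (RtoC 72) with (RtoC 2 * RtoC 2 * RtoC 18) by (rewrite <- !RtoC_mult; f_equal; ring).
  replace (RtoC 4) with (RtoC 2 * RtoC 2) by (rewrite <- !RtoC_mult; f_equal; ring).
  field; auto.
Qed.

(* Two solutions of [(U')^2 = quartic A U] with double zeros [U ~ -2 A z^2] at [0]:
   their difference [D] satisfies [D' (U' + V') = D * quartic_slope A U V], whose
   coefficients behave like [-8 A z] and [-8 A], so [D' ~ D / z], while [D = O(z^2)]. *)
Lemma quartic_solution_unique (A r0 : R) (s ds w dw : C -> C) :
  (0 < A)%R -> (0 < r0)%R ->
  (forall z, Cmod z < r0 -> Cderiv s z (ds z)) ->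
  (forall z, Cmod z < r0 -> Cderiv w z (dw z)) ->
  s (RtoC 0) = (- RtoC 2) * RtoC A -> w (RtoC 0) = RtoC 0 ->
  dw (RtoC 0) * dw (RtoC 0) = (- RtoC 2) * RtoC A ->
  (forall z, 0 < Cmod z < r0 ->
     (RtoC 2 * z * s z + z * z * ds z) * (RtoC 2 * z * s z + z * z * ds z)
       = quartic (RtoC A) (z * z * s z)) ->
  (forall z, 0 < Cmod z < r0 ->
     (RtoC 2 * w z * dw z) * (RtoC 2 * w z * dw z) = quartic (RtoC A) (w z * w z)) ->
  exists d, (0 < d)%R /\ forall z, 0 < Cmod z < d -> z * z * s z = w z * w z.
Proof.
  intros HA Hr Hs Hw Hs0 Hw0 Hdw0 HqS HqW.
  assert (H00 : (Cmod (RtoC 0) < r0)%R) by (rewrite Cmod_0; exact Hr).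
  assert (Ls : lim0 s ((- RtoC 2) * RtoC A)).
  { rewrite <- Hs0. exact (lim0_Cderiv s _ (Hs _ H00)). }
  assert (Lds : lim0 ds (ds (RtoC 0))) by exact (lim0_continuous _ (derivative_continuous_at_0 s ds r0 Hr Hs)).
  assert (Ldw : lim0 dw (dw (RtoC 0))) by exact (lim0_continuous _ (derivative_continuous_at_0 w dw r0 Hr Hw)).
  assert (Lom : lim0 (fun z => w z / z) (dw (RtoC 0))) by exact (lim0_quotient w _ Hw0 (Hw _ H00)).
  assert (Lp : lim0 (fun z => z * z * s z) (RtoC 0)).
  { eapply lim0_eq; [repeat apply lim0_mult; try apply lim0_id; exact Ls | ring]. }
  assert (Lw : lim0 w (RtoC 0)).
  { rewrite <- Hw0. exact (lim0_Cderiv w _ (Hw _ H00)). }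
  assert (Lu : lim0 (fun z => w z * w z) (RtoC 0)).
  { eapply lim0_eq; [apply lim0_mult; exact Lw | ring]. }
  assert (LH : lim0 (fun z => quartic_slope (RtoC A) (z * z * s z) (w z * w z)) ((- RtoC 8) * RtoC A)).
  { unfold quartic_slope. eapply lim0_eq.
    - repeat first [ apply lim0_plus | apply Lp | apply Lu | apply lim0_const | apply lim0_mult ].
    - ring. }
  (* This is [(U' + V') / z] for [U = z^2 s] and [V = w^2]. The terms [2 s(0)] and [2 w'(0)^2]
     contribute [-4 A] each. *)
  assert (LT : lim0 (fun z => RtoC 2 * s z + z * ds z + RtoC 2 * (w z / z) * dw z) ((- RtoC 8) * RtoC A)).
  { eapply lim0_eq.
    - repeat first [ apply lim0_plus | apply Ls | apply Lds | apply Ldw | apply Lom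
                   | apply lim0_id | apply lim0_const | apply lim0_mult ].
    - replace (RtoC 2 * dw (RtoC 0) * dw (RtoC 0)) with (RtoC 2 * (dw (RtoC 0) * dw (RtoC 0))) by ring.
      rewrite Hdw0. replace (RtoC 8) with (RtoC 2 * RtoC 2 + RtoC 2 * RtoC 2)
        by (rewrite <- !RtoC_mult, <- RtoC_plus; f_equal; ring). ring. }
  assert (LE : lim0 (fun z => s z + (- RtoC 1) * ((w z / z) * (w z / z))) (RtoC 0)).
  { eapply lim0_eq.
    - repeat first [ apply lim0_plus | apply Ls | apply Lom | apply lim0_const | apply lim0_mult ].
    - rewrite Hdw0. ring. }
  (* With tolerance [A] the slope is at most [9 * A] and the divided sum at least [7 * A] in
     modulus; the ratio [9 / 7] is below the [3 / 2] that [singular_gronwall] allows. *)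
  destruct (LH A HA) as [d1 [Hd1 B1]]. destruct (LT A HA) as [d2 [Hd2 B2]].
  destruct (LE 1%R Rlt_0_1) as [d3 [Hd3 B3]].
  set (d := Rmin (Rmin d1 d2) (Rmin d3 r0)).
  assert (Hd : (0 < d)%R) by (repeat apply Rmin_pos; assumption).
  assert (Hdd : (d <= d1 /\ d <= d2 /\ d <= d3 /\ d <= r0)%R).
  { assert (X1 := Rmin_l (Rmin d1 d2) (Rmin d3 r0)). assert (X2 := Rmin_r (Rmin d1 d2) (Rmin d3 r0)).
    assert (X3 := Rmin_l d1 d2). assert (X4 := Rmin_r d1 d2).
    assert (X5 := Rmin_l d3 r0). assert (X6 := Rmin_r d3 r0). unfold d. lra. }
  exists d. split; [exact Hd|]. intros z Hz.
  assert (HD : (fun z => z * z * s z - w z * w z) z = RtoC 0).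
  2:{ cbv beta in HD. replace (z * z * s z) with ((z * z * s z - w z * w z) + w z * w z) by ring.
      rewrite HD. ring. }
  assert (H8 : Cmod ((- RtoC 8) * RtoC A) = (8 * A)%R).
  { rewrite Cmod_mult, Cmod_opp, !Cmod_R, !Rabs_right by lra. ring. }
  revert z Hz.
  apply (singular_gronwall _ (fun z => (RtoC 2 * z * s z + z * z * ds z) - RtoC 2 * w z * dw z) d 1).
  - intros z Hz. apply Cderiv_minus.
    + eapply Cderiv_eq.
      * apply Cderiv_mult; [apply Cderiv_mult; apply Cderiv_id | apply Hs; lra].
      * cbv beta. replace (RtoC 2) with (RtoC 1 + RtoC 1) by (rewrite <- RtoC_plus; f_equal; ring). ring.
    + eapply Cderiv_eq; [apply Cderiv_mult; apply Hw; lra|].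
      replace (RtoC 2) with (RtoC 1 + RtoC 1) by (rewrite <- RtoC_plus; f_equal; ring). ring.
  - intros z Hz.
    assert (Hz0 : z <> RtoC 0) by (apply Cmod_gt_0; lra).
    specialize (B1 z ltac:(lra)). specialize (B2 z ltac:(lra)).
    assert (Q : (z * ((RtoC 2 * z * s z + z * z * ds z) - RtoC 2 * w z * dw z))
        * (RtoC 2 * s z + z * ds z + RtoC 2 * (w z / z) * dw z)
      = (z * z * s z - w z * w z) * quartic_slope (RtoC A) (z * z * s z) (w z * w z)).
    { rewrite <- quartic_sub, <- HqS, <- HqW by lra. field. exact Hz0. }
    apply (f_equal Cmod) in Q. rewrite (Cmod_mult (z * _)), (Cmod_mult z), (Cmod_mult (_ - _)) in Q.
    set (T := RtoC 2 * s z + z * ds z + RtoC 2 * (w z / z) * dw z) in *.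
    set (H := quartic_slope (RtoC A) (z * z * s z) (w z * w z)) in *.
    set (e := Cmod (z * z * s z - w z * w z)) in *.
    set (f := (Cmod z * Cmod (RtoC 2 * z * s z + z * z * ds z - RtoC 2 * w z * dw z))%R) in *.
    assert (0 <= e)%R by apply Cmod_ge_0.
    assert (0 <= f)%R by (apply Rmult_le_pos; apply Cmod_ge_0).
    assert (T1 := Cmod_triangle (H - (- RtoC 8) * RtoC A) ((- RtoC 8) * RtoC A)).
    replace (H - (- RtoC 8) * RtoC A + (- RtoC 8) * RtoC A) with H in T1 by ring.
    assert (T2 := Cmod_triangle (- (T - (- RtoC 8) * RtoC A)) T).
    replace (- (T - (- RtoC 8) * RtoC A) + T) with ((- RtoC 8) * RtoC A) in T2 by ring.
    rewrite Cmod_opp, H8 in T2. rewrite H8 in T1.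
    assert (f * (7 * A) <= f * Cmod T)%R by (apply Rmult_le_compat_l; lra).
    assert (e * Cmod H <= e * (9 * A))%R by (apply Rmult_le_compat_l; lra).
    assert (f * 7 <= e * 9)%R by (apply (Rmult_le_reg_r A); lra).
    cbv beta. fold f. fold e. lra.
  - intros z Hz. specialize (B3 z ltac:(lra)).
    assert (Hz0 : z <> RtoC 0) by (apply Cmod_gt_0; lra).
    replace (z * z * s z - w z * w z) with ((z * z) * (s z + (- RtoC 1) * (w z / z * (w z / z)) - RtoC 0))
      by (field; exact Hz0).
    rewrite !(Cmod_mult (z * z)), Cmod_mult.
    assert (0 <= Cmod z * Cmod z)%R by (apply Rmult_le_pos; apply Cmod_ge_0). nra.
Qed.

(** * Comparison of the two solutions and continuation to the disc *)

Theorem theorem6 (kappa : R) (hk : (0 < kappa < 1)%R)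
  (w dw : C -> C) (r : R) (hr : (0 < r)%R)
  (hw : forall z, Cmod z < r ->
          Cderiv w z (dw z) /\
          dw z * dw z = T6 (w z) - RtoC (1 - 2 * kappa ^ 2))
  (hw0 : w (RtoC 0) = RtoC 0)
  (P dP : C -> C) (rho : R) (hrho : (0 < rho)%R)
  (hP : weierstrass_local (RtoC (48 * (1 + 8 * kappa ^ 2)))
                          (RtoC (64 * (1 - 20 * kappa ^ 2 - 8 * kappa ^ 4)))
                          rho P dP) :
  let lambda := sqrt (1 - kappa ^ 2) in
  forall z, 0 < Cmod z < Rmin r rho ->
    (RtoC 1 + (RtoC 2 * w z * w z - RtoC 1)) * (RtoC 6 - P z)
      = RtoC (4 * lambda ^ 2).
Proof.
  intros lambda z Hz.
  set (A := (1 - kappa ^ 2)%R).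
  assert (HA : (0 < A)%R) by (unfold A; nra).
  assert (El : (4 * lambda ^ 2 = 4 * A)%R) by (unfold lambda; rewrite pow2_sqrt; [reflexivity | fold A; lra]).
  assert (Ek : (kappa ^ 2 = 1 - A)%R) by (unfold A; ring).
  assert (Ek4 : (kappa ^ 4 = (1 - A) ^ 2)%R) by (unfold A; ring).
  rewrite Ek4, Ek in hP. rewrite Ek in hw. rewrite El. clear lambda El Ek Ek4.
  assert (Hw : forall z, Cmod z < r -> Cderiv w z (dw z)) by (intros; apply hw; assumption).
  assert (Hdw : forall z, Cmod z < r -> dw z * dw z = T6 (w z) - (RtoC 2 * RtoC A - RtoC 1)).
  { intros y Hy. destruct (hw y Hy) as [_ ->]. f_equal. rewrite <- RtoC_mult, <- RtoC_minus. f_equal. ring. }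
  destruct hP as [HP [h [dh [Hh HPh]]]].
  set (B := fun z => RtoC 6 * (z * z) - RtoC 1 - z * z * h z).
  set (dB := fun z => RtoC 12 * z - (RtoC 2 * z * h z + z * z * dh z)).
  assert (HB : forall z, Cmod z < rho -> Cderiv B z (dB z)).
  { intros y Hy. eapply Cderiv_eq.
    - unfold B. apply Cderiv_minus.
      + apply Cderiv_minus; [|apply Cderiv_const].
        apply Cderiv_mult; [apply Cderiv_const | apply Cderiv_mult; apply Cderiv_id].
      + apply Cderiv_mult; [apply Cderiv_mult; apply Cderiv_id | apply Hh, Hy].
    - unfold dB. replace (RtoC 12) with (RtoC 6 * RtoC 2) by (rewrite <- RtoC_mult; f_equal; ring).
      replace (RtoC 2) with (RtoC 1 + RtoC 1) by (rewrite <- RtoC_plus; f_equal; ring). ring. }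
  assert (HB0 : B (RtoC 0) = (- RtoC 1)) by (unfold B; ring).
  assert (H6P : forall z, 0 < Cmod z < rho -> RtoC 6 - P z = B z / (z * z)).
  { intros y Hy. assert (y <> RtoC 0) by (apply Cmod_gt_0; lra).
    rewrite (HPh y Hy). unfold B. field. assumption. }
  assert (Hnear : exists d, (0 < d)%R /\ forall z, Cmod z < d -> B z <> RtoC 0).
  { destruct (Cderiv_continuous B (RtoC 0) (dB (RtoC 0))) with (eps := (/ 2)%R) as [d [Hd H]].
    - apply HB. rewrite Cmod_0. exact hrho.
    - lra.
    - exists d. split; [exact Hd|]. intros y Hy E. specialize (H y).
      replace (y - RtoC 0) with y in H by ring. specialize (H Hy).
      rewrite E, HB0 in H. replace (RtoC 0 - (- RtoC 1)) with (RtoC 1) in H by (ring).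
      rewrite Cmod_1 in H. lra. }
  destruct Hnear as [d0 [Hd0 HBn]].
  set (r0 := Rmin d0 (Rmin r rho)).
  assert (Hr0 : (0 < r0)%R) by (repeat apply Rmin_pos; assumption).
  assert (Hr0' : (r0 <= d0 /\ r0 <= r /\ r0 <= rho)%R).
  { assert (X1 := Rmin_l d0 (Rmin r rho)). assert (X2 := Rmin_r d0 (Rmin r rho)).
    assert (X3 := Rmin_l r rho). assert (X4 := Rmin_r r rho). unfold r0. lra. }
  (* The cofactor of the double zero: [2 A / (6 - P)] equals [z^2 s], and [s] is holomorphic at [0]
     with value [-2 A]. *)
  set (s := fun z => RtoC 2 * RtoC A * / B z).
  set (ds := fun z => RtoC 2 * RtoC A * (- dB z / (B z * B z))).
  assert (Hs : forall z, Cmod z < r0 -> Cderiv s z (ds z)).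
  { intros y Hy. eapply Cderiv_eq.
    - unfold s. apply Cderiv_mult; [apply Cderiv_const|].
      apply Cderiv_inv; [apply HBn; lra | apply HB; lra].
    - unfold ds. ring. }
  destruct (quartic_solution_unique A r0 s ds w dw HA Hr0 Hs) as [d [Hd Hloc]].
  - intros y Hy. apply Hw. lra.
  - unfold s. rewrite HB0. field.
  - exact hw0.
  - rewrite Hdw by (rewrite Cmod_0; exact hr). rewrite hw0, T6_expand. ring.
  - intros y Hy. assert (Hy0 : y <> RtoC 0) by (apply Cmod_gt_0; lra).
    assert (HBy : B y <> RtoC 0) by (apply HBn; lra).
    assert (Hyr : 0 < Cmod y < rho) by lra.
    destruct (HP y Hyr) as [HdP HodeP].
    assert (H6 : RtoC 6 - P y <> RtoC 0).
    { rewrite H6P by exact Hyr. intros E. apply HBy.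
      replace (B y) with (B y / (y * y) * (y * y)) by (field; exact Hy0). rewrite E. ring. }
    assert (Ep : RtoC 2 * RtoC A / (RtoC 6 - P y) = y * y * s y).
    { rewrite H6P by exact Hyr. unfold s. field. auto. }
    assert (Ed : RtoC 2 * RtoC A * dP y / ((RtoC 6 - P y) * (RtoC 6 - P y))
      = RtoC 2 * y * s y + y * y * ds y).
    { apply (Cderiv_unique (fun x => x * x * s x) y).
      - apply (Cderiv_ext_loc (fun x => RtoC 2 * RtoC A * / (RtoC 6 - P x)) _ y _ (Rmin (Cmod y) (r0 - Cmod y))).
        + apply Rmin_pos; lra.
        + intros x Hx.
          assert (X1 := Rlt_le_trans _ _ _ Hx (Rmin_l _ _)).
          assert (X2 := Rlt_le_trans _ _ _ Hx (Rmin_r _ _)).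
          assert (T1 := Cmod_triangle (x - y) y). replace (x - y + y) with x in T1 by ring.
          assert (T2 := Cmod_triangle (- (x - y)) x). replace (- (x - y) + x) with y in T2 by ring.
          rewrite Cmod_opp in T2.
          assert (x <> RtoC 0) by (apply Cmod_gt_0; lra).
          rewrite H6P by lra. unfold s. field. split; [apply HBn; lra | assumption].
        + eapply Cderiv_eq.
          * apply Cderiv_mult; [apply Cderiv_const|].
            apply (Cderiv_inv (fun x => RtoC 6 - P x)); [exact H6|].
            apply Cderiv_minus; [apply Cderiv_const | exact HdP].
          * cbv beta. field. exact H6.
      - eapply Cderiv_eq.
        + apply Cderiv_mult; [apply Cderiv_mult; apply Cderiv_id | apply Hs; lra].
        + cbv beta. replace (RtoC 2) with (RtoC 1 + RtoC 1) by (rewrite <- RtoC_plus; f_equal; ring). ring. }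
    rewrite <- Ed, <- Ep. apply weierstrass_quartic; assumption.
  - intros y Hy. apply square_quartic. apply Hdw. lra.
  - set (F := fun z => RtoC 2 * (w z * w z) * B z - RtoC 4 * RtoC A * (z * z)).
    assert (HF : F z = RtoC 0).
    { apply (identity_theorem_disc F (Rmin r rho) (Rmin d d0)).
      - now apply Rmin_pos.
      - intros y Hy. eexists. unfold F. apply Cderiv_minus.
        + apply Cderiv_mult.
          * apply Cderiv_mult; [apply Cderiv_const|].
            apply Cderiv_mult; apply Hw; eapply Rlt_le_trans; [exact Hy | apply Rmin_l | exact Hy | apply Rmin_l].
          * apply HB. eapply Rlt_le_trans; [exact Hy | apply Rmin_r].
        + apply Cderiv_mult; [apply Cderiv_const | apply Cderiv_mult; apply Cderiv_id].
      - intros y Hy. assert (X1 := Rmin_l d d0). assert (X2 := Rmin_r d d0).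
        unfold F. destruct (Ceq_dec y (RtoC 0)) as [->|Hy0].
        + rewrite hw0. ring.
        + rewrite <- Hloc by (split; [now apply Cmod_gt_0 | lra]).
          unfold s. replace (RtoC 4) with (RtoC 2 * RtoC 2) by (rewrite <- RtoC_mult; f_equal; ring).
          field. apply HBn. lra.
      - apply Hz. }
    assert (X1 := Rmin_l r rho). assert (X2 := Rmin_r r rho).
    assert (Hz0 : z <> RtoC 0) by (apply Cmod_gt_0; lra).
    rewrite H6P by lra. unfold F in HF. rewrite RtoC_mult.
    (* The left-hand side of the claim is [F z / z^2 + 4 A]. *)
    replace ((RtoC 1 + (RtoC 2 * w z * w z - RtoC 1)) * (B z / (z * z)))
      with ((RtoC 2 * (w z * w z) * B z - RtoC 4 * RtoC A * (z * z)) / (z * z) + RtoC 4 * RtoC A)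
      by (field; exact Hz0).
    rewrite HF. field. exact Hz0.
Qed.
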